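(* Let $r,s$ be nonnegative integers, let $v$ be a positive integer, and let $m\ge 4$ be even. Suppose that $m\mid v$, $r+s=v-1$, $s\ne 1$, $(r,v)\ne(0,6)$, $(m,r,v)\ne(4,0,4)$, and that at least one of the following conditions holds: (1) $m>4$, $s\ne 3$ and $m\equiv 0\pmod 4$; (2) $m>4$, $\frac{v}{m}$ is even, $s\ne 3$ and $m\equiv 2\pmod 4$; (3) $m=4$ and $v\equiv 0,8,16\pmod{24}$; (4) $m=4$, $v\equiv 12\pmod{24}$ and $s\notin\{3,5\}$; (5) $m=4$, $v\equiv 4,20\pmod{24}$ and $r$ is odd. Then $\mathrm{HWP}^*(v;2^r,m^s)$ has a solution.
   Context: $K_v^*$ is the complete symmetric digraph on $v$ vertices (both arcs $(x,y)$ and $(y,x)$ for every pair of distinct vertices). $\vec{C}_n$ denotes the directed cycle on $n$ vertices; for $n=2$ it is $K_2^*$, the digraph with two vertices $x,y$ and the two arcs $(x,y),(y,x)$. For a digraph $H$, an $H$-factor of a digraph $D$ is a spanning subdigraph of $D$ that is a vertex-disjoint union of copies of $H$. A solution to $\mathrm{HWP}^*(v;m^r,n^s)$ is a partition of the arc set of $K_v^*$ into $r$ $\vec{C}_m$-factors and $s$ $\vec{C}_n$-factors; thus a solution to $\mathrm{HWP}^*(v;2^r,m^s)$ is a partition of the arc set of $K_v^*$ into $r$ $K_2^*$-factors and $s$ $\vec{C}_m$-factors. *)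

(* Defs.v *)
From HB Require Import structures.
From mathcomp Require Import all_boot.

Set Implicit Arguments.
Unset Strict Implicit.
Unset Printing Implicit Defensive.

(* A digraph without parallel arcs on a finType T is given by its arc set
   D : {set T * T}, the pair (x, y) being the arc from x to y; its vertex set
   is all of T. *)

Definition complete_digraph (v : nat) : {set 'I_v * 'I_v} :=
  [set a | a.1 != a.2].

(* ordS is the cyclic successor i |-> i + 1 mod n. For n = 2 this is K_2^*;
   the intended range is n >= 2 (for n = 1 it is a loop). *)
Definition dicycle (n : nat) : {set 'I_n * 'I_n} :=
  [set a | a.2 == ordS a.1].

Definition copy_vertices (S T : finType) (f : S -> T) : {set T} :=
  [set f x | x in [set: S]].

Definition copy_arcs (S T : finType) (H : {set S * S}) (f : S -> T) :
    {set T * T} :=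
  [set (f a.1, f a.2) | a in H].

(* F is the arc set of an H-factor of D: the k injections f_i are the copies
   of H, pairwise vertex-disjoint and together spanning T. *)
Definition is_factor (S T : finType) (H : {set S * S}) (D F : {set T * T}) :
    Prop :=
  F \subset D /\
  exists (k : nat) (f : 'I_k -> S -> T),
    [/\ forall i, injective (f i),
        forall i j, i != j ->
          [disjoint copy_vertices (f i) & copy_vertices (f j)],
        \bigcup_(i < k) copy_vertices (f i) = [set: T]
      & F = \bigcup_(i < k) copy_arcs H (f i)].

(* partition forbids empty blocks; for v > 0 and m, n >= 2 every factor has
   arcs, so this is no restriction. Disjointness of P and Q matters only when
   m = n. *)
Definition HWP_has_solution (v m r n s : nat) : Prop :=
  exists P Q : {set {set 'I_v * 'I_v}},
    [/\ #|P| = r /\ #|Q| = s,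
        [disjoint P & Q],
        partition (P :|: Q) (complete_digraph v),
        forall F, F \in P -> is_factor (dicycle m) (complete_digraph v) F
      & forall F, F \in Q -> is_factor (dicycle n) (complete_digraph v) F].

(* Main.v *)
(* An undirected C_m-factor with m even can be used either as two directed
   C_m-factors or as two K_2^*-factors. It therefore suffices to decompose K_v into
   undirected C_m-factors and a base part having few factors and the right parity.

   Cut the vertex set into j blocks of size 4p, where m = 2k and k divides 2p. The
   edges between blocks form K_j[4p]. In the one-factorization GK of K_2j any two
   consecutive one-factors form a Hamiltonian cycle, so K_j[2] = K_2j - F_0 splits
   into even cycles; these lift along Z_p to cycles whose lengths are multiples of
   2p, and Haggkvist's lemma turns every such 2-factor, with its vertices doubled,
   into two C_m-factors.

   Inside a block of 4t vertices, use K_4t = K_2t[2] + I. Three consecutive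
   one-factors of GK form a ladder, the other ones pair up into Hamiltonian cycles
   to which Haggkvist's lemma applies. The doubled ladder, with or without I, has
   explicit decompositions that are periodic along the ladder: a window of columns
   can be repeated any number q of times. They are verified for all q at once by
   comparing symbolic lists of arcs. The blocks of size 8 and 12 needed for m = 4
   are handled by explicit lists. *)

Require Import Defs.
From HB Require Import structures.
From mathcomp Require Import all_boot perm fingroup zify.

Set Implicit Arguments.
Unset Strict Implicit.
Unset Printing Implicit Defensive.

(** * Permutations all of whose cycles have the same length *)

Definition cycp (T : finType) (n : nat) (s : {perm T}) : Prop :=
  forall x j, (iter j s x == x) = (n %| j).

Lemma iter_perm_mod (T : finType) n (s : {perm T}) x j :
  cycp n s -> iter (j %% n) s x = iter j s x.
Proof.
move=> cs; rewrite [in RHS](divn_eq j n) addnC iterD; congr iter.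
by apply/eqP; rewrite eq_sym cs dvdn_mull.
Qed.

Lemma cycp_iter_inj (T : finType) n (s : {perm T}) x i j :
  cycp n s -> i < n -> j < n -> iter i s x = iter j s x -> i = j.
Proof.
wlog le_ij: i j / i <= j.
  move=> H cs; case: (leqP i j) => [|/ltnW] ij li lj e; first exact: H.
  exact/esym/(H j i).
move=> cs _ ltj e; suff: n %| j - i by case: (posnP (j - i)) => [? _|h /(dvdn_leq h)]; lia.
rewrite -(cs x); apply/eqP.
have inji : injective (iter i s).
  by elim: (i) => // k IHk y z /perm_inj/IHk.
by apply: inji; rewrite -iterD subnKC // -e.
Qed.

(** Here [c] names the cycle of a point and [l] its position on it. The two determine the point, and
    [f] only advances the position modulo [n]; so [f] is injective and a point first returns after
    exactly [n] steps. *)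
Lemma perm_of_labels (T : finType) (C : eqType) n (f : T -> T) (c : T -> C)
    (l : T -> nat) :
  (forall x, l x < n) -> (forall x, c (f x) = c x) ->
  (forall x, l (f x) = (l x).+1 %% n) ->
  (forall x y, c x = c y -> l x = l y -> x = y) ->
  exists2 s : {perm T}, s =1 f & cycp n s.
Proof.
move=> ltl cf lf inj.
have cj x j : c (iter j f x) = c x by elim: j => //= j IH; rewrite cf.
have lj x j : l (iter j f x) = (l x + j) %% n.
  elim: j => [|j IH] /=; first by rewrite addn0 modn_small.
  by rewrite lf IH -[X in X %% _ = _]addn1 modnDml addn1 addnS.
have fi : injective f.
  move=> x y e; apply: inj; first by rewrite -cf e cf.
  have: l (f x) == l (f y) by rewrite e.
  rewrite !lf -(addn1 (l x)) -(addn1 (l y)) eqn_modDr.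
  by rewrite !modn_small // => /eqP.
exists (perm fi) => [x|x j]; first by rewrite permE.
rewrite (eq_iter (permE fi)).
apply/eqP/idP => [e|nj].
  have: l (iter j f x) == l x by rewrite e.
  rewrite lj -[X in _ == X](modn_small (ltl x)) -[X in _ == X %% _]addn0.
  by rewrite eqn_modDl mod0n.
apply: inj; first exact: cj.
by rewrite lj -modnDmr (eqP nj) addn0 modn_small.
Qed.

Section FactorOfPerm.
Variables (T : finType) (m : nat) (s : {perm T}).
Hypotheses (m_gt1 : 1 < m) (cs : cycp m s).

Definition graph_perm : {set T * T} := [set a | a.2 == s a.1].

Lemma is_factor_graph_perm (D : {set T * T}) :
  (forall x y, x != y -> (x, y) \in D) -> is_factor (dicycle m) D graph_perm.
Proof.
move=> memD; split.
  apply/subsetP => -[x y]; rewrite inE /= => /eqP ->; apply: memD.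
  by rewrite eq_sym (cs x 1) dvdn1; case: (m) m_gt1 => [|[]].
have fs : injective s := @perm_inj _ s.
have sym := fconnect_sym fs.
(* One copy of the dicycle for each orbit of [s]: vertex [j] goes to the [j]-th iterate of the root
   of the orbit. *)
exists #|froots s|, (fun i (j : 'I_m) => iter j s (enum_val i)).
have rootP (i : 'I_#|froots s|) : froot s (enum_val i) = enum_val i.
  by apply/eqP; have := enum_valP i.
have m0 : 0 < m by lia.
have cover z : exists i (j : 'I_m), z = iter j s (enum_val (i : 'I_#|froots s|)).
  have rz : froot s z \in froots s by exact: (roots_root sym).
  exists (enum_rank_in rz (froot s z)), (Ordinal (ltn_pmod (findex s (froot s z) z) m0)).
  rewrite enum_rankK_in //= iter_perm_mod // iter_findex //.
  by rewrite sym; exact: connect_root.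
split.
- move=> i j k /= /(cycp_iter_inj cs (ltn_ord j) (ltn_ord k)); exact: val_inj.
- move=> i i' ne; apply/pred0P => z /=; apply/negP => /andP[].
  case/imsetP => j _ -> /imsetP[j' _ e].
  case/eqP: ne; apply: enum_val_inj; rewrite -(rootP i) -(rootP i').
  apply/eqP; rewrite (root_connect sym).
  apply: (connect_trans (fconnect_iter s j _)).
  by rewrite e sym fconnect_iter.
- apply/setP => z; rewrite inE; apply/bigcupP.
  by have [i [j ->]] := cover z; exists i => //; apply: imset_f.
- apply/setP => -[x y]; rewrite inE /=; apply/eqP/bigcupP.
    move=> ->; have [i [j ->]] := cover x; exists i => //.
    apply/imsetP; exists (j, ordS j); first by rewrite inE.
    by congr pair; rewrite /= iter_perm_mod.
  case=> i _ /imsetP[[j k]]; rewrite inE /= => /eqP -> [-> ->].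
  by rewrite /= iter_perm_mod.
Qed.

End FactorOfPerm.

(** * Decompositions of weighted digraphs *)

Section Decompositions.
Variable T : finType.
Implicit Types (L : seq {perm T}) (w : T -> T -> nat).

Definition mulp L (x y : T) : nat := count (fun s : {perm T} => s x == y) L.

(* [w x y] is the multiplicity of the arc (x, y); in [unddec] every permutation
   contributes both orientations of its cycles. *)
Definition dirdec (P : {perm T} -> Prop) w k :=
  exists L, [/\ size L = k, forall s, s \in L -> P s
              & forall x y, mulp L x y = w x y].

Definition unddec (P : {perm T} -> Prop) w k :=
  exists L, [/\ size L = k, forall s, s \in L -> P s
              & forall x y, mulp L x y + mulp L y x = w x y].

Lemma mulp_cat L1 L2 x y : mulp (L1 ++ L2) x y = mulp L1 x y + mulp L2 x y.
Proof. exact: count_cat. Qed.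

Lemma eq_dirdec P w w' k : (forall x y, w x y = w' x y) ->
  dirdec P w k -> dirdec P w' k.
Proof. by move=> e [L [? ? H]]; exists L; split=> // x y; rewrite H. Qed.

Lemma eq_unddec P w w' k : (forall x y, w x y = w' x y) ->
  unddec P w k -> unddec P w' k.
Proof. by move=> e [L [? ? H]]; exists L; split=> // x y; rewrite H. Qed.

Lemma dirdec0 P : dirdec P (fun _ _ => 0) 0.
Proof. by exists [::]. Qed.

Lemma unddec0 P : unddec P (fun _ _ => 0) 0.
Proof. by exists [::]. Qed.

Lemma dirdecD P w1 w2 k1 k2 : dirdec P w1 k1 -> dirdec P w2 k2 ->
  dirdec P (fun x y => w1 x y + w2 x y) (k1 + k2).
Proof.
move=> [L1 [s1 P1 H1]] [L2 [s2 P2 H2]]; exists (L1 ++ L2); split.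
- by rewrite size_cat s1 s2.
- by move=> s; rewrite mem_cat => /orP[/P1|/P2].
- by move=> x y; rewrite mulp_cat H1 H2.
Qed.

Lemma unddecD P w1 w2 k1 k2 : unddec P w1 k1 -> unddec P w2 k2 ->
  unddec P (fun x y => w1 x y + w2 x y) (k1 + k2).
Proof.
move=> [L1 [s1 P1 H1]] [L2 [s2 P2 H2]]; exists (L1 ++ L2); split.
- by rewrite size_cat s1 s2.
- by move=> s; rewrite mem_cat => /orP[/P1|/P2].
- by move=> x y; rewrite !mulp_cat -H1 -H2; lia.
Qed.

Lemma unddec_split P w a b : unddec P w (a + b) -> exists w1 w2,
  [/\ unddec P w1 a, unddec P w2 b & forall x y, w x y = w1 x y + w2 x y].
Proof.
move=> [L [sL PL HL]].
exists (fun x y => mulp (take a L) x y + mulp (take a L) y x).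
exists (fun x y => mulp (drop a L) x y + mulp (drop a L) y x); split.
- exists (take a L); split=> //; first by rewrite size_takel // sL leq_addr.
  by move=> s /mem_take/PL.
- exists (drop a L); split=> //; first by rewrite size_drop sL addKn.
  by move=> s /mem_drop/PL.
- by move=> x y; rewrite -HL -{1 2}(cat_take_drop a L) !mulp_cat; lia.
Qed.

End Decompositions.

Lemma cycpV (T : finType) m (s : {perm T}) : cycp m s -> cycp m s^-1%g.
Proof.
move=> cs x j; rewrite -(cs x) -!permX expgVn -(inj_eq (@perm_inj _ (s ^+ j)%g)).
by rewrite permKV eq_sym.
Qed.

(* Equivalently, [k] divides the length of every cycle of [s]. *)
Definition labp (T : finType) k (s : {perm T}) : Prop :=
  exists l : T -> nat, forall x, l (s x) = (l x).+1 %[mod k].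

Lemma labp_dvd (T : finType) k d (s : {perm T}) : d %| k -> labp k s -> labp d s.
Proof.
move=> dk [l H]; exists l => x.
by rewrite -(modn_dvdm (l (s x)) dk) H modn_dvdm.
Qed.

(** The label is the distance from the root of the orbit; it falls from [m - 1] back to 0 when the
    orbit closes up. *)
Lemma cycp_labp (T : finType) m (s : {perm T}) : 0 < m -> cycp m s -> labp m s.
Proof.
move=> m0 cs; have sym := fconnect_sym (@perm_inj _ s).
exists (fun x => findex s (froot s x) x) => x.
have rE y : iter (findex s (froot s y) y) s (froot s y) = y.
  by apply: iter_findex; rewrite sym; exact: connect_root.
have re : froot s (s x) = froot s x.
  by apply/eqP; rewrite (root_connect sym) sym fconnect1.
apply: (cycp_iter_inj (x := froot s x) cs); rewrite ?ltn_pmod //.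
by rewrite !iter_perm_mod //= rE -{1}re rE.
Qed.

Lemma mulp_map (T T' : finType) (g : {perm T} -> {perm T'}) L x y :
  mulp (map g L) x y = count (fun s => g s x == y) L.
Proof. exact: count_map. Qed.

Lemma unddec_dirdec (T : finType) m (w : T -> T -> nat) k :
  unddec (cycp m) w k -> dirdec (cycp m) w k.*2.
Proof.
move=> [L [sL PL HL]]; exists (L ++ map invg L); split.
- by rewrite size_cat size_map sL addnn.
- by move=> s; rewrite mem_cat => /orP[/PL //|/mapP[t /PL ct ->]]; apply: cycpV.
move=> x y; rewrite -HL mulp_cat mulp_map; congr addn.
by apply: eq_count => s; rewrite (canF_eq (permKV s)) eq_sym.
Qed.

(** The weight pulled back along [p] is that of a blow-up of the base graph. It is treated one base
    factor at a time, so only the blow-up of a single factor has to be decomposed. *)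
Lemma unddec_bind (T T' : finType) (p : T' -> T) (P : {perm T} -> Prop) P' c w k :
  (forall s, P s -> unddec P' (fun u v => (s (p u) == p v) + (s (p v) == p u)) c) ->
  unddec P w k -> unddec P' (fun u v => w (p u) (p v)) (k * c).
Proof.
move=> H [L [sL PL HL]]; apply: (@eq_unddec _ _
  (fun u v => mulp L (p u) (p v) + mulp L (p v) (p u))) => [u v|]; first exact: HL.
rewrite -{}sL; elim: L PL {HL} => [_|s L IH PL] /=; first exact: unddec0.
rewrite mulSn; apply: eq_unddec (unddecD (H s _) (IH _)).
- by move=> u v /=; lia.
- by apply: PL; rewrite mem_head.
- by move=> t tL; apply: PL; rewrite inE tL orbT.
Qed.

Lemma unddec_dirdec_bind (T : finType) (P P' : {perm T} -> Prop) c w k :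
  (forall s, P s -> dirdec P' (fun u v => (s u == v) + (s v == u)) c) ->
  unddec P w k -> dirdec P' w (k * c).
Proof.
move=> H [L [sL PL HL]]; apply: (@eq_dirdec _ _
  (fun u v => mulp L u v + mulp L v u)) => [u v|]; first exact: HL.
rewrite -{}sL; elim: L PL {HL} => [_|s L IH PL] /=; first exact: dirdec0.
rewrite mulSn; apply: eq_dirdec (dirdecD (H s _) (IH _)).
- by move=> u v /=; lia.
- by apply: PL; rewrite mem_head.
- by move=> t tL; apply: PL; rewrite inE tL orbT.
Qed.

Lemma cycp2P (T : finType) (s : {perm T}) :
  (forall x, s (s x) = x) -> (forall x, s x != x) -> cycp 2 s.
Proof.
move=> ss ns x j; rewrite dvdn2.
have -> : iter j s x = if odd j then s x else x.
  by elim: j => //= j ->; case: (odd j); rewrite //= ss.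
by case: (odd j); rewrite ?eqxx //; apply/negbTE.
Qed.

(** An even cycle is the union of two perfect matchings, and a perfect matching, read as a
    fixed-point-free involution, is a K_2^*-factor. *)
Lemma unddec_matchings (T : finType) m (w : T -> T -> nat) k :
  0 < m -> ~~ odd m -> unddec (cycp m) w k -> dirdec (cycp 2) w k.*2.
Proof.
move=> m0 em; rewrite -muln2; apply: unddec_dirdec_bind => s cs.
have [l Hl] : labp 2 s.
  by apply: labp_dvd (cycp_labp m0 cs); rewrite dvdn2.
have ol x : odd (l (s x)) = ~~ odd (l x).
  by have := Hl x; rewrite !modn2; case: (odd (l (s x))) => /=; case: (odd (l x)).
have ol' x : odd (l (s^-1%g x)) = ~~ odd (l x).
  by rewrite -{2}(permKV s x) ol negbK.
have nsx x : s x != x by apply/eqP => e; have := ol x; rewrite e; case: odd.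
(* [f b] exchanges the ends of each edge along which [s] leaves a vertex of label parity [b]. *)
pose f b x := if odd (l x) == b then s x else s^-1%g x.
have ff b : involutive (f b).
  move=> x; rewrite /f; case: (eqVneq (odd (l x)) b) => [<-|].
    by rewrite ol; case: (odd (l x)) => /=; rewrite permK.
  by rewrite ol'; case: (odd (l x)); case: b => //= _; rewrite permKV.
pose t b := perm (inv_inj (ff b)).
exists [:: t true; t false]; split=> //.
  move=> u; rewrite !inE => u2.
  have [b ->] : exists b, u = t b by case/orP: u2 => /eqP ->; [exists true|exists false].
  apply: cycp2P => x; rewrite !permE ?ff // /f; case: ifP => // _.
  by rewrite -(inj_eq (@perm_inj _ s)) permKV eq_sym.
move=> x y; rewrite /mulp /= !permE /f addn0 (_ : (s y == x) = (s^-1%g x == y)); last by rewrite (canF_eq (permKV s)) eq_sym.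
by case: (odd (l x)) => //=; rewrite addnC.
Qed.

Lemma graph_perm_inj (T : finType) : injective (@graph_perm T).
Proof.
move=> s t e; apply/permP => x; apply/eqP.
have : (x, s x) \in graph_perm s by rewrite inE.
by rewrite e inE /=.
Qed.

(** Lists of permutations become sets of factors. Since every arc is covered once, the listed
    permutations are distinct and the sets keep the cardinalities. *)
Lemma dirdec_HWP (v m r s : nat) (w1 w2 : 'I_v -> 'I_v -> nat) :
  0 < v -> 1 < m -> dirdec (cycp 2) w1 r -> dirdec (cycp m) w2 s ->
  (forall x y, w1 x y + w2 x y = (x != y)) -> HWP_has_solution v 2 r m s.
Proof.
move=> v0 m1 [A [sA PA HA]] [B [sB PB HB]] H.
have H1 x y : mulp (A ++ B) x y = (x != y) by rewrite mulp_cat HA HB H.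
have x0 : 'I_v by exact: Ordinal v0.
(* A permutation [u] listed twice would cover the arc from [x0] to [u x0] twice. *)
have uAB : uniq (A ++ B).
  apply: count_mem_uniq => u; case: (boolP (u \in A ++ B)) => [uAB|/count_memPn ->//].
  apply/eqP; rewrite eqn_leq -has_count has_pred1 uAB andbT.
  have: mulp (A ++ B) x0 (u x0) <= 1 by rewrite H1 leq_b1.
  by apply: leq_trans; apply: sub_count => t /= /eqP ->.
have [uA dAB uB] : [/\ uniq A, ~~ has (mem A) B & uniq B].
  by apply/and3P; rewrite -cat_uniq.
have card_graph (L : seq {perm 'I_v}) : uniq L ->
    #|[set F in map (@graph_perm _) L]| = size L.
  move=> uL; rewrite cardsE -(size_map (@graph_perm _)); apply/card_uniqP.
  by rewrite map_inj_uniq //; exact: graph_perm_inj.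
exists [set F in map (@graph_perm _) A], [set F in map (@graph_perm _) B].
split.
- by rewrite !card_graph.
- apply/pred0P => F /=; rewrite !inE; apply/negP => /andP[/mapP[a aA ->] /mapP[b bB]].
  move/graph_perm_inj => ab; case/negP: dAB; apply/hasP; exists b => //=.
  by rewrite -ab.
- have memU F : F \in [set F in map (@graph_perm _) A] :|: [set F in map (@graph_perm _) B]
      -> exists2 u, u \in A ++ B & F = graph_perm u.
    rewrite !inE => /orP[] /mapP[u uu ->]; exists u => //; rewrite mem_cat uu ?orbT //.
  have memU' u : u \in A ++ B -> graph_perm u \in
      [set F in map (@graph_perm _) A] :|: [set F in map (@graph_perm _) B].
    by rewrite mem_cat !inE => /orP[] uu; rewrite (map_f _ uu) ?orbT.
  apply/and3P; split.
  + rewrite /cover; apply/eqP/setP => -[x y]; rewrite [RHS]inE /=; apply/bigcupP/idP.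
      case=> F /memU[u uAB' ->]; rewrite inE /= => /eqP e.
      by rewrite -(lt0b (x != y)) -H1 -has_count; apply/hasP; exists u; rewrite //= e.
    rewrite -(lt0b (x != y)) -H1 -has_count => /hasP[u uAB'] /= /eqP e.
    by exists (graph_perm u); rewrite ?memU' // inE /= e.
  + apply/trivIsetP => F G /memU[a aAB ->] /memU[b bAB ->] ne.
    apply/pred0P => -[x y] /=; rewrite !inE /=; apply/negP => /andP[/eqP ea /eqP eb].
    have: mulp (A ++ B) x y <= 1 by rewrite H1 leq_b1.
    have nab : a != b by apply: contraNneq ne => ->.
    have sub : uniq [:: a; b] by rewrite /= inE nab.
    have: {subset [:: a; b] <= filter (fun u : {perm 'I_v} => u x == y) (A ++ B)}.
      by move=> u; rewrite !inE mem_filter => /orP[] /eqP ->; rewrite ?aAB ?bAB -?ea -?eb eqxx.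
    by move/(uniq_leq_size sub); rewrite size_filter ltnNge => /negP.
  + apply/negP => /memU[u _ e]; have : (x0, u x0) \in graph_perm u by rewrite inE.
    by rewrite -e inE.
- move=> F; rewrite inE => /mapP[u /PA cu ->]; apply: is_factor_graph_perm => //.
  by move=> x y; rewrite inE.
- move=> F; rewrite inE => /mapP[u /PB cu ->]; apply: is_factor_graph_perm => //.
  by move=> x y; rewrite inE.
Qed.

(* [r] factors of type K_2^*, [s] directed and [c] undirected C_m-factors. *)
Definition sol (T : finType) m (w : T -> T -> nat) r s c : Prop :=
  exists w1 w2 w3 : T -> T -> nat,
    [/\ dirdec (cycp 2) w1 r, dirdec (cycp m) w2 s, unddec (cycp m) w3 c
      & forall x y, w1 x y + w2 x y + w3 x y = w x y].

Lemma eq_sol (T : finType) m (w w' : T -> T -> nat) r s c :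
  (forall x y, w x y = w' x y) -> sol m w r s c -> sol m w' r s c.
Proof.
by move=> e [w1 [w2 [w3 [H1 H2 H3 H]]]]; exists w1, w2, w3; split=> // x y; rewrite H.
Qed.

Lemma sol_addU (T : finType) m (w w' : T -> T -> nat) r s c c' :
  sol m w r s c -> unddec (cycp m) w' c' ->
  sol m (fun x y => w x y + w' x y) r s (c + c').
Proof.
move=> [w1 [w2 [w3 [H1 H2 H3 H]]]] H'.
exists w1, w2, (fun x y => w3 x y + w' x y); split=> //; first exact: unddecD.
by move=> x y; rewrite -H !addnA.
Qed.

(** Of the undirected factors, [a] are split into matchings and [b] are oriented both ways; this is
    the freedom that reaches all [r] and [s] of the right parity. *)
Lemma sol_HWP v m r s c a b : 0 < v -> 1 < m -> ~~ odd m ->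
  sol m (fun x y : 'I_v => x != y : nat) r s c -> a + b = c ->
  HWP_has_solution v 2 (r + a.*2) m (s + b.*2).
Proof.
move=> v0 m1 em [w1 [w2 [w3 [H1 H2 H3 H]]]] ab; rewrite -{}ab in H3.
have [wa [wb [Ha Hb Hab]]] := unddec_split H3.
have H1' := dirdecD H1 (unddec_matchings (ltnW m1) em Ha).
have H2' := dirdecD H2 (unddec_dirdec Hb).
apply: (dirdec_HWP v0 m1 H1' H2') => x y /=.
by rewrite -H Hab; lia.
Qed.

(** * Transport of decompositions along maps of the vertex set *)

Section Lift.
Variables (T T' : finType) (p : T' -> T) (e : rel T') (P : {perm T} -> Prop).
Variable (P' : {perm T'} -> Prop).
Hypothesis lift_perm : forall s, P s -> exists2 t, P' t &
  forall u v, (t u == v) = e u v && (s (p u) == p v).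

Lemma lift_seq (L : seq {perm T}) : (forall s, s \in L -> P s) ->
  exists L', [/\ size L' = size L, forall s, s \in L' -> P' s
              & forall u v, mulp L' u v = e u v * mulp L (p u) (p v)].
Proof.
elim: L => [_|s L IH PL]; first by exists [::]; split=> // u v; rewrite muln0.
have [|t Pt Ht] := lift_perm (s := s); first by apply: PL; rewrite mem_head.
have [|L' [sL' PL' HL']] := IH; first by move=> x xL; apply: PL; rewrite inE xL orbT.
exists (t :: L'); split=> /=; first by rewrite sL'.
  by move=> x; rewrite inE => /orP[/eqP ->|/PL'].
by move=> u v; rewrite /mulp /= Ht mulnDr -HL'; case: (e u v); rewrite ?mul1n.
Qed.

Lemma dirdec_lift w k : dirdec P w k ->
  dirdec P' (fun u v => e u v * w (p u) (p v)) k.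
Proof.
move=> [L [sL PL HL]]; have [L' [sL' PL' HL']] := lift_seq PL.
by exists L'; split=> //; [rewrite sL'|move=> u v; rewrite HL' HL].
Qed.

Lemma unddec_lift w k : symmetric e -> unddec P w k ->
  unddec P' (fun u v => e u v * w (p u) (p v)) k.
Proof.
move=> se [L [sL PL HL]]; have [L' [sL' PL' HL']] := lift_seq PL.
exists L'; split=> //; first by rewrite sL'.
by move=> u v; rewrite !HL' (se v) -mulnDr HL.
Qed.

End Lift.

(** The relation [e] limits which vertices may be joined: it is constantly true for a relabelling of
    the vertices, and equality of block indices for disjoint copies. *)
Lemma sol_lift (T T' : finType) (p : T' -> T) (e : rel T') m w r s c :
  (forall n s, cycp n s -> exists2 t, cycp n t &
     forall u v, (t u == v) = e u v && (s (p u) == p v)) ->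
  symmetric e -> sol m w r s c ->
  sol m (fun u v => e u v * w (p u) (p v)) r s c.
Proof.
move=> H se [w1 [w2 [w3 [H1 H2 H3 Hw]]]].
exists (fun u v => e u v * w1 (p u) (p v)), (fun u v => e u v * w2 (p u) (p v)).
exists (fun u v => e u v * w3 (p u) (p v)); split.
- exact: (dirdec_lift (H 2) H1).
- exact: (dirdec_lift (H m) H2).
- exact: (unddec_lift (H m) se H3).
- by move=> u v; rewrite -!mulnDr Hw.
Qed.

Section Iso.
Variables (T T' : finType) (f : T' -> T) (g : T -> T').
Hypotheses (fK : cancel f g) (gK : cancel g f).

Let conj_inj (s : {perm T}) : injective (fun x => g (s (f x))).
Proof. by move=> x y /(can_inj gK)/perm_inj/(can_inj fK). Qed.

Let iter_conj (s : {perm T}) x j :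
  iter j (perm (@conj_inj s)) x = g (iter j s (f x)).
Proof. by elim: j => [|j IH] /=; rewrite ?fK // IH permE gK. Qed.

Lemma iso_cycp n s : cycp n s -> exists2 t, cycp n t &
  forall u v : T', (t u == v) = true && (s (f u) == f v).
Proof.
move=> cs; exists (perm (@conj_inj s)) => [x j|u v].
  by rewrite iter_conj (can2_eq gK fK) cs.
by rewrite permE (can2_eq gK fK).
Qed.

Lemma sol_iso m w r s c : sol m w r s c -> sol m (fun u v => w (f u) (f v)) r s c.
Proof.
move=> /(sol_lift (e := fun _ _ => true) iso_cycp (fun _ _ => erefl)).
by apply: eq_sol => x y; rewrite mul1n.
Qed.

Lemma unddec_iso_cycp m w c : unddec (cycp m) w c ->
  unddec (cycp m) (fun u v => w (f u) (f v)) c.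
Proof.
move=> /(unddec_lift (e := fun _ _ => true) (@iso_cycp m) (fun _ _ => erefl)).
by apply: eq_unddec => x y; rewrite mul1n.
Qed.

End Iso.

Lemma block_cycp (I T : finType) n (s : {perm T}) : cycp n s ->
  exists2 t, cycp n t &
    forall u v : I * T, (t u == v) = (u.1 == v.1) && (s u.2 == v.2).
Proof.
move=> cs.
have inj : injective (fun u : I * T => (u.1, s u.2)).
  by move=> [i x] [j y] [-> /perm_inj ->].
have it x j : iter j (perm inj) x = (x.1, iter j s x.2).
  by elim: j => [|j IH] /=; [case: x | rewrite IH permE].
exists (perm inj) => [[i x] j|u [i x]].
  by rewrite it -pair_eqE /pair_eq /= eqxx cs.
by rewrite permE -pair_eqE.
Qed.

(** The same permutation acts on all blocks at once, so the number of factors spent inside the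
    blocks does not depend on the number of blocks. *)
Lemma sol_blocks (I T : finType) m r s c c' :
  sol m (fun x y : T => x != y : nat) r s c ->
  unddec (cycp m) (fun u v : I * T => u.1 != v.1 : nat) c' ->
  sol m (fun x y : I * T => x != y : nat) r s (c + c').
Proof.
move=> /(sol_lift (@block_cycp I T)) H /(sol_addU (H _)) {}H.
apply: eq_sol (H _) => [[i x] [j y] /=|[i x] [j y] /=]; last by rewrite eq_sym.
by rewrite -pair_eqE /pair_eq /=; case: eqVneq; case: eqVneq.
Qed.

(** * Lifting cycles to blown-up graphs *)

Section Haggkvist.
Variables (T : finType) (k : nat) (s : {perm T}).
Hypothesis k_gt1 : 1 < k.

(* Haggkvist's lemma. The first factor runs forward through one copy of the base
   cycle and backward through the other one, turning at the vertices labelled 0;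
   the second one is its image under the twist [phi]. *)
Lemma haggkvist : labp k s ->
  unddec (cycp k.*2)
    (fun u v : T * bool => (s u.1 == v.1) + (s v.1 == u.1)) 2.
Proof.
move=> [l0 Hl0]; pose l x := l0 x %% k.
have ltl x : l x < k by rewrite ltn_pmod // ltnW.
have Hl x : l (s x) = (l x).+1 %% k by rewrite /l Hl0 -addn1 -(addn1 (_ %% _)) modnDml.
have ls x : l (s x) = if (l x).+1 == k then 0 else (l x).+1.
  rewrite Hl; case: eqVneq => [->|ne]; first exact: modnn.
  by rewrite modn_small // ltn_neqAle ne ltl.
(* The copy [false] is run forward and the copy [true] backward; arriving at label 0 switches the
   direction. *)
pose f (u : T * bool) := if u.2 then (s^-1%g u.1, l (s^-1%g u.1) != 0)
                         else (s u.1, l (s u.1) == 0).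
(* A cycle leaves a vertex of label 0, goes forward through positions 0 to [k - 1], turns at
   position [k] over the next vertex of label 0, and comes back. [lam] is the position and [ct] the
   starting vertex. *)
pose lam (u : T * bool) :=
  if u.2 then (if l u.1 == 0 then k else k.*2 - l u.1) else l u.1.
pose ct (u : T * bool) := iter (if u.2 && (l u.1 == 0) then k else l u.1) s^-1%g u.1.
have itV j x : iter j.+1 s^-1%g (s x) = iter j s^-1%g x by rewrite iterSr permK.
have [||||t tE ct'] := @perm_of_labels _ _ k.*2 f ct lam.
- by move=> [x []]; rewrite /lam /=; have := ltl x; [case: (eqVneq (l x) 0)|]; lia.
- move=> [x [|]] /=.
    rewrite -(permKV s x); move: (s^-1%g x) => y.
    rewrite /ct /f /= permK andNb ls.
    by case: (eqVneq (l y).+1 k) => [<-|_] /=; rewrite -?iterS itV.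
  rewrite /ct /f /= ls.
  by case: (eqVneq (l x).+1 k) => [e|_] /=; rewrite -?[in LHS]e -?iterS itV.
- move=> [x [|]] /=.
    rewrite -(permKV s x); move: (s^-1%g x) => y.
    rewrite /lam /f /= permK ls; have := ltl y.
    case: (eqVneq (l y).+1 k); case: (eqVneq (l y) 0) => /= ? ? ?; try lia.
    + by rewrite modn_small; lia.
    + by rewrite (_ : _.+1 = k.*2) ?modnn; lia.
    + by rewrite modn_small; lia.
  rewrite /lam /f /= ls; have := ltl x.
  by case: (eqVneq (l x).+1 k) => [e|ne] /= ?; rewrite modn_small; lia.
- move=> [x a] [y b]; rewrite /lam /ct /=; have := ltl x; have := ltl y.
  case: a; case: b => /=; case: (eqVneq (l x) 0) => [xe|xn]; case: (eqVneq (l y) 0) => [ye|yn];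
    move=> ly lx e le; try lia; congr pair; move: e; try (have -> : l x = l y by lia);
    rewrite -!permX; try exact: perm_inj; rewrite ?xe ?ye; exact: perm_inj.
(* The twist exchanges the copies over even labels. Between two nonzero labels the first factor
   joins equal copies, so the second joins different ones. Over a base edge at a vertex of label 0,
   the first factor meets one copy of this vertex and the second meets the other. *)
pose tw x := ~~ odd (l x).
pose phi (u : T * bool) := (u.1, u.2 (+) tw u.1).
have phiK : cancel phi phi by move=> [x a]; rewrite /phi /= addbK.
have [t2 ct2 t2E] := iso_cycp phiK phiK ct'.
exists [:: t; t2]; split=> //; first by move=> z; rewrite !inE => /orP[] /eqP ->.
have tEE x a y b : (t (x, a) == (y, b)) =
    (s x == y) && (~~ a && (b == (l y == 0))) +
    (s y == x) && (a && (b == (l y != 0))) :> nat.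
  rewrite tE /f; case: a => /=; rewrite -pair_eqE /pair_eq /=.
    rewrite [s^-1%g x == y]eq_sym -(canF_eq (permK s)) andbF add0n.
    by case: (eqVneq (s y) x) => //= <-; rewrite permK eq_sym.
  by rewrite andbF addn0; case: (eqVneq (s x) y) => //= <-; rewrite eq_sym.
(* [A] counts how often the two factors, in either direction, use the edge between [(x, a)] and
   [(y, b)] lying over the base arc from [x] to [y]. *)
pose A x a y b := (~~ a && (b == (l y == 0))) + (b && (a == (l x != 0)))
  + (~~ (a (+) tw x) && (b (+) tw y == (l y == 0)))
  + ((b (+) tw y) && (a (+) tw x == (l x != 0))).
have A1 x a y b : s x = y -> A x a y b = 1.
  move=> <-; rewrite /A /tw ls; have := ltl x.
  case: (eqVneq (l x).+1 k) => /= [e _|ne _]; case: (eqVneq (l x) 0) => /= [e0|_].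
  - by lia.
  - by case: a; case: b; case: odd.
  - by rewrite e0; case: a; case: b.
  - by case: a; case: b; case: odd.
move=> [x a] [y b]; rewrite /mulp /= !t2E /phi /= !tEE.
transitivity ((s x == y) * A x a y b + (s y == x) * A y b x a).
  by rewrite /A; case: (s x == y); case: (s y == x); rewrite /= ?mul1n ?mul0n; lia.
by congr addn; case: eqVneq => //= /A1 ->.
Qed.

End Haggkvist.

Lemma count_enum (T : finType) (P : pred T) : count P (enum T) = \sum_x P x.
Proof. by rewrite -sum1_count big_mkcond big_enum /=; apply: eq_bigr => x; case: (P x). Qed.

Section CyclicLift.
Variables (T : finType) (p : nat) (s : {perm T}).

Definition ordD (a : 'I_p) k : 'I_p :=
  Ordinal (ltn_pmod (a + k) (leq_ltn_trans (leq0n a) (ltn_ord a))).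

Lemma ordD_inj k : injective (ordD^~ k).
Proof.
move=> a b [/eqP]; rewrite eqn_modDr !modn_small // => /eqP; exact: val_inj.
Qed.

(* The voltages are [c] and [1 - c] alternately, so that two steps shift the
   fibre by 1, whatever [c]. *)
Lemma cyclic_lift : labp 2 s ->
  unddec (labp p.*2)
    (fun u v : T * 'I_p => (s u.1 == v.1) + (s v.1 == u.1)) p.
Proof.
move=> [l Hl]; have ol x : odd (l (s x)) = ~~ odd (l x).
  by have := Hl x; rewrite !modn2; case: (odd (l (s x))) => /=; case: (odd (l x)).
(* [(p - c).+1] stands for [1 - c] modulo [p]. *)
pose sh (c : 'I_p) x := if odd (l x) then (p - c).+1 else c : nat.
have inj c : injective (fun u : T * 'I_p => (s u.1, ordD u.2 (sh c u.1))).
  by move=> [x a] [y b] [/perm_inj <-] e; congr pair; apply/ordD_inj/val_inj/e.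
(* Over a base arc, two given points of the fibres are joined for exactly one voltage, the [c0]
   below. *)
have one x y a b : \sum_(c < p) ((perm (@inj c) (x, a) == (y, b)) : nat) = (s x == y).
  have p0 : 0 < p by apply: leq_ltn_trans (ltn_ord a).
  pose c0 : 'I_p := Ordinal (ltn_pmod (if odd (l x) then a + (p - b).+1 else b + (p - a)) p0).
  transitivity (\sum_(c < p) (if c == c0 then (s x == y) : nat else 0)); last first.
    by rewrite -big_mkcond big_pred1_eq.
  apply: eq_bigr => c _; rewrite permE -pair_eqE /pair_eq /=.
  case: (s x == y); last by case: ifP.
  rewrite -!val_eqE /= /sh {c0}; have := ltn_ord a; have := ltn_ord b; have := ltn_ord c.
  move: (a : nat) (b : nat) (c : nat) => {}a {}b {}c lc lb la.
  suff -> : ((a + (if odd (l x) then (p - c).+1 else c)) %% p == b) =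
     (c == (if odd (l x) then a + (p - b).+1 else b + (p - a)) %% p) by case: eqVneq.
  have red n : n < p.*2.+1 -> n %% p = if n < p then n else if n < p.*2 then n - p else 0.
    move=> ln; case: ltnP => h1; first by rewrite modn_small.
    case: ltnP => h2.
      by rewrite -[in LHS](subnK h1) modnDr modn_small //; lia.
    by rewrite (_ : n = 2 * p) ?modnMl; lia.
  by case: odd; rewrite !red; try lia; do 4?case: ltnP => ?; lia.
exists [seq perm (@inj c) | c <- enum 'I_p]; split.
- by rewrite size_map size_enum_ord.
- move=> _ /mapP[c _ ->].
  (* Two steps raise the fibre coordinate by 1, so twice that coordinate labels the even vertices;
     over an odd vertex the voltage [c] of the preceding step is first subtracted. *)
  exists (fun u : T * 'I_p => if odd (l u.1) then ((u.2 + (p - c)) %% p).*2.+1 else u.2.*2).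
  move=> [x a]; rewrite permE /= /sh ol; have la := ltn_ord a; have lc := ltn_ord c.
  have dm n : (n %% p).*2 = n.*2 %% p.*2 by rewrite -!muln2 muln_modl.
  case: odd => /=; first by rewrite !dm -[in RHS]addn2 modnDml modn_mod addnS doubleS addn2.
  by rewrite modnDml -addnA subnKC ?(ltnW lc) // modnDr (modn_small la).
- move=> [x a] [y b] /=; by rewrite -(one x y a b) -(one y x b a) /mulp; congr addn; rewrite count_map count_enum.
Qed.

End CyclicLift.

Lemma modn_lt2 p n : n < p.*2 -> n %% p = if n < p then n else n - p.
Proof.
move=> ln; case: ltnP => h1; first by rewrite modn_small.
by rewrite -[in LHS](subnK h1) modnDr modn_small //; lia.
Qed.

(** * The one-factorization GK of the complete graph *)

Section GK.
Variables (t n : nat).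
Hypotheses (t_gt1 : 1 < t) (n_def : n.+1 = t.*2).

(* The vertices are those of Z_n together with the point at infinity, coded by
   [n]; the edges of colour [c] are the pairs {x, c - x} and {oo, c/2}. *)
Definition gkcol (x y : nat) : nat :=
  if x == n then y.*2 %% n else if y == n then x.*2 %% n else (x + y) %% n.

(* The Hamiltonian cycle oo, 0, 1, -1, 2, -2, ... formed by the colours 0 and 1. *)
Lemma gk_zigzag : exists2 s : {perm 'I_n.+1}, cycp t.*2 s &
  forall x y, (s x == y) + (s y == x) = (x != y) && (gkcol x y <= 1).
Proof.
(* The last vertex before the return to [n] is [t], reached from [t - 1]; [l] is the position along
   the cycle, counted from [n]. *)
pose f0 x := if x == n then 0 else if x == 0 then 1 else
  if x < t then n - x else if x == t then n else (n - x).+1.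
pose l (x : 'I_n.+1) : nat := if x == n :> nat then 0 else if x == 0 :> nat then 1 else
  if x < t then x.*2 else ((n - x).*2).+1.
have f0lt x : x < n.+1 -> f0 x < n.+1.
  rewrite /f0 => lx; do 4?case: ifP => ?; lia.
pose f (x : 'I_n.+1) := Ordinal (f0lt x (ltn_ord x)).
have [|||| s sE cs] := @perm_of_labels _ unit t.*2 f (fun _ => tt) l.
- move=> x; have := ltn_ord x; rewrite /l; do 3?case: ifP => ?; lia.
- by [].
- move=> [x lx]; rewrite /l /f /= /f0.
  case: (eqVneq x n) => [?|?] /=.
    have -> : (0 == n) = false by lia.
    by rewrite modn_small; lia.
  case: (eqVneq x 0) => [?|?] /=.
    have -> : (1 == n) = false by lia.
    have -> : (1 < t) by lia.
    by rewrite /= modn_small; lia.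
  case: (ltnP x t) => [?|?] /=.
    have -> : (n - x == n) = false by lia.
    have -> : (n - x == 0) = false by lia.
    have -> : (n - x < t) = false by lia.
    by rewrite modn_small; lia.
  case: (eqVneq x t) => [->|?] /=.
    rewrite eqxx (_ : _.+2 = t.*2); last by lia.
    by rewrite modnn.
  have -> : ((n - x).+1 == n) = false by lia.
  have -> : ((n - x).+1 < t) by lia.
  by rewrite modn_small; lia.
- move=> x y _; have := ltn_ord x; have := ltn_ord y; rewrite /l.
  by move=> ly lx e; apply: val_inj => /=; move: e; do 6?case: ifP => ?; lia.
exists s => // x y; rewrite !sE -!val_eqE /f /= /f0 /gkcol.
have := ltn_ord x; have := ltn_ord y; move: (nat_of_ord x) (nat_of_ord y) => {}x {}y ly lx.
case: (eqVneq x n) => [?|?].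
  case: (eqVneq y n) => [?|?]; first by lia.
  rewrite modn_lt2; last by lia.
  by case: (eqVneq y 0) => ?; case: (ltnP y t) => ?; case: (eqVneq y t) => ?; case: ltnP => ?; lia.
case: (eqVneq y n) => [?|?].
  rewrite modn_lt2; last by lia.
  by case: (eqVneq x 0) => ?; case: (ltnP x t) => ?; case: (eqVneq x t) => ?; case: ltnP => ?; lia.
rewrite modn_lt2; last by lia.
by case: (eqVneq x 0) => ?; case: (ltnP x t) => ?; case: (eqVneq x t) => ?;
  case: (eqVneq y 0) => ?; case: (ltnP y t) => ?; case: (eqVneq y t) => ?;
  case: ltnP => ?; lia.
Qed.

Let n_gt0 : 0 < n. Proof. by lia. Qed.

Definition gkshift h (x : 'I_n.+1) : 'I_n.+1 :=
  if x == n :> nat then x else inord ((x + h) %% n).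

Lemma val_gkshift h x : gkshift h x = (if x == n :> nat then n else (x + h) %% n) :> nat.
Proof.
rewrite /gkshift; case: eqP => [->//|_]; rewrite inordK //.
by apply: ltn_trans (ltnSn n); rewrite ltn_pmod.
Qed.

Lemma gkshiftK h h' : h + h' = 0 %[mod n] -> cancel (gkshift h) (gkshift h').
Proof.
move=> hh x; apply: val_inj; rewrite /= !val_gkshift.
case: (eqVneq (x : nat) n) => [->|ne]; first by rewrite eqxx.
rewrite ltn_eqF ?ltn_pmod // modnDml -addnA -modnDmr hh mod0n addn0 modn_small //.
by have := ltn_ord x; lia.
Qed.

Lemma gkcol_shift h x y : x != y ->
  gkcol (gkshift h x) (gkshift h y) = (gkcol x y + h.*2) %% n.
Proof.
rewrite -val_eqE /gkcol !val_gkshift => /= xy.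
have dm m : (m %% n).*2 = m.*2 %[mod n].
  by rewrite -!muln2 modnMml.
have lp m : (m %% n == n) = false by rewrite ltn_eqF // ltn_pmod.
case: (eqVneq (x : nat) n) => [xn|xn]; case: (eqVneq (y : nat) n) => [yn|yn];
  rewrite ?eqxx ?lp ?modnDml.
- by rewrite xn yn eqxx in xy.
- by rewrite dm doubleD.
- by rewrite dm doubleD.
- by rewrite modnDmr; congr modn; lia.
Qed.

(** A translation by [h] that fixes the point at infinity adds [2 * h] to all colours. As [n] is
    odd, [2 * h] can be made [- c], which turns the colours [c] and [c + 1] into 0 and 1. *)
Lemma gk_pair c : c.+1 < n -> exists2 s : {perm 'I_n.+1}, cycp t.*2 s &
  forall x y, (s x == y) + (s y == x) = (x != y) && (c <= gkcol x y < c.+2).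
Proof.
move=> lc; have [s0 cs0 Hs0] := gk_zigzag.
(* [t] is the inverse of 2 modulo [n]. *)
pose h := (n - c) * t.
have hh : h.*2 = n - c %[mod n].
  rewrite -muln2 -mulnA muln2 -n_def mulnS -modnDmr -[n in _ * n]mul1n.
  by rewrite mul1n modnMl addn0.
have h1 : h + (n - h %% n) = 0 %[mod n].
  by rewrite -modnDml subnKC ?modnn ?mod0n // ltnW // ltn_pmod.
have h2 : (n - h %% n) + h = 0 %[mod n] by rewrite addnC.
have [s cs Hs] := iso_cycp (gkshiftK h1) (gkshiftK h2) cs0.
exists s => // x y; rewrite !Hs /= Hs0 (inj_eq (can_inj (gkshiftK h1))).
case: (eqVneq x y) => //= xy; rewrite gkcol_shift // -modnDmr hh modnDmr; congr nat_of_bool.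
have : gkcol x y < n by rewrite /gkcol; do 2?case: ifP => _; rewrite ltn_pmod.
move: (gkcol x y) => g lg; case: (leqP c g) => h3.
  have -> : (g + (n - c)) = g - c + n by lia.
  by rewrite modnDr modn_small; lia.
by rewrite modn_small; lia.
Qed.

Lemma gk_interval lo j : lo + j.*2 <= n -> unddec (cycp t.*2)
  (fun x y : 'I_n.+1 => (x != y) && (lo <= gkcol x y < lo + j.*2) : nat) j.
Proof.
elim: j => [|j IH] lj.
  apply: (@eq_unddec _ _ (fun _ _ => 0)); last exact: unddec0.
  by move=> x y; rewrite addn0; case: eqP => //= _; lia.
have [s cs Hs] := @gk_pair (lo + j.*2) ltac:(lia).
have Hs1 : unddec (cycp t.*2) (fun x y => (s x == y) + (s y == x)) 1.
  exists [:: s]; split=> // [u|x y]; first by rewrite inE => /eqP ->.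
  by rewrite /mulp /= !addn0.
have := unddecD (IH ltac:(lia)) Hs1; rewrite addn1.
by apply: eq_unddec => x y; rewrite Hs; case: eqP => //= _; lia.
Qed.

End GK.

(* The cubic graph formed by the colours -1, 0 and 1 is a ladder with columns
   {2i, 2i+1}, except that the two vertices of the column {0, 1} are the apices
   of its two ends. *)
Definition ladder_edge t u v := [|| (u./2 == v./2) && (u < v), (1 < u) && (v == u.+2),
  (u == 0) && ((v == 2) || (v == 3)) |
  (u == 1) && ((v == t.*2.-2) || (v == t.*2.-1))].

Definition ladder t u v := ladder_edge t u v || ladder_edge t v u.

(** * Coordinates that exhibit the ladder in GK *)

Section GKCodes.
Variables (t n : nat).
Hypotheses (t_gt1 : 1 < t) (n_def : n.+1 = t.*2).

(* The vertices of the i-th column are i and -i, in an order that depends on the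
   parity of i in order to make the rails straight. *)
Definition gkpoint u := if u == 0 then 0 else if u == 1 then n else
  if odd u != odd u./2 then u./2 else n - u./2.

Definition gkcode x := if x == 0 then 0 else if x == n then 1 else
  if x < t then x.*2 + ~~ odd x else (n - x).*2 + odd (n - x).

Lemma gkpoint_lt u : u < t.*2 -> gkpoint u < n.+1.
Proof. by rewrite /gkpoint -{1}(odd_double_half u); do 3?case: ifP => _; lia. Qed.

Lemma gkcode_lt x : x < n.+1 -> gkcode x < t.*2.
Proof.
move=> lx; rewrite /gkcode; case: ifP => ?; first by lia.
case: ifP => ?; first by lia.
by case: ifP => ?; [case: (odd x) | case: (odd (n - x))]; lia.
Qed.

Lemma gkpointK u : u < t.*2 -> gkcode (gkpoint u) = u.
Proof.
have := odd_double_half u; move: (odd u) (u./2) => b i <- lu.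
rewrite /gkpoint half_bit_double oddD odd_double addbF oddb.
case: (posnP i) => [->|i0]; first by case: b lu => /= ?; rewrite /gkcode ?eqxx //; case: eqP => ?; lia.
have -> : (b + i.*2 == 0) = false by lia.
have -> : (b + i.*2 == 1) = false by lia.
rewrite /gkcode; case: (boolP (b != odd i)) => bi.
  have -> : (i == 0) = false by lia.
  have -> : (i == n) = false by lia.
  have -> : (i < t) by lia.
  by move: bi lu; case: b; case: odd => //=; lia.
have -> : (n - i == 0) = false by lia.
have -> : (n - i == n) = false by lia.
have -> : (n - i < t) = false by lia.
rewrite subKn; last by lia.
by move: bi lu; case: b; case: odd => //=; lia.
Qed.

Lemma gkcodeK x : x < n.+1 -> gkpoint (gkcode x) = x.
Proof.
move=> lx; rewrite /gkcode; case: (eqVneq x 0) => [->//|x0].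
case: (eqVneq x n) => [->//|xn]; case: ltnP => xt; rewrite /gkpoint.
  have -> : (x.*2 + ~~ odd x == 0) = false by lia.
  have -> : (x.*2 + ~~ odd x == 1) = false by lia.
  rewrite addnC half_bit_double oddD odd_double addbF oddb.
  by case: (odd x).
have -> : ((n - x).*2 + odd (n - x) == 0) = false by lia.
have -> : ((n - x).*2 + odd (n - x) == 1) = false by lia.
rewrite addnC half_bit_double oddD odd_double addbF oddb eqxx /=; lia.
Qed.

Definition gkccol u v := gkcol n (gkpoint u) (gkpoint v).

(** Equal signs force distinct [i] and [j], so the colour is plus or minus [i + j] with
    [3 <= i + j <= n - 2], never 0, 1 or -1 modulo [n]. Opposite signs give the difference of [i]
    and [j]. *)
Lemma gkccol_pos (b c : bool) i j : 0 < i < t -> 0 < j < t -> (b != c) || (i != j) ->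
  let x := if b then i else n - i in let y := if c then j else n - j in
  ((gkcol n x y == 0) = (b != c) && (i == j)) *
  ((gkcol n x y <= 1) || (gkcol n x y == n.-1) = [&& b != c, i <= j.+1 & j <= i.+1]).
Proof.
move=> hi hj; rewrite /gkcol; case: b; case: c => /= ij.
all: rewrite !ifF ?modn_lt2; try lia.
all: by case: ltnP => ?; split; lia.
Qed.

Lemma ladder_pos (b c : bool) i j : 0 < i < t -> 0 < j < t -> b + i.*2 != c + j.*2 ->
  ladder t (b + i.*2) (c + j.*2) =
  [&& (b != odd i) != (c != odd j), i <= j.+1 & j <= i.+1].
Proof.
move=> hi hj; have edgeE (b' c' : bool) i' j' : 0 < i' -> 0 < j' ->
    ladder_edge t (b' + i'.*2) (c' + j'.*2) =
    ((i' == j') && (~~ b' && c')) || ((b' == c') && (j' == i'.+1)).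
  move=> i0 j0; rewrite /ladder_edge !half_bit_double.
  have -> : (b' + i'.*2 == 0) = false by lia.
  have -> : (b' + i'.*2 == 1) = false by lia.
  have -> : 1 < b' + i'.*2 by lia.
  have -> : (c' + j'.*2 == (b' + i'.*2).+2) = (b' == c') && (j' == i'.+1).
    by case: b'; case: c'; lia.
  rewrite /= orbF; congr orb; case: (eqVneq i' j') => [<-|//] /=.
  by rewrite ltn_add2r; case: b'; case: c'.
by rewrite /ladder !edgeE; lia.
Qed.

Lemma gkcolC x y : gkcol n x y = gkcol n y x.
Proof. by rewrite /gkcol addnC; case: eqVneq => [->|_]; case: eqVneq => // ->. Qed.

Lemma ladderC u v : ladder t u v = ladder t v u.
Proof. exact: orbC. Qed.

Lemma gkpoint_bit (d : bool) k : 0 < k ->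
  gkpoint (d + k.*2) = if d != odd k then k else n - k.
Proof.
move=> k0; rewrite /gkpoint half_bit_double oddD odd_double addbF oddb.
by do 2![rewrite ifF; last by lia].
Qed.

(** The codes 0 and 1 are the points 0 and infinity. The colours 1 and -1 join 0 to the points 1 and
    -1, and infinity to their halves [t] and [t - 1], which form the last column. *)
Lemma gkccol_end (b c : bool) j : 0 < j < t ->
  (gkccol b (c + j.*2) != 0) *
  ((gkccol b (c + j.*2) <= 1) || (gkccol b (c + j.*2) == n.-1) = ladder t b (c + j.*2)).
Proof.
move=> hj; have ladE : ladder t b (c + j.*2) = (j == if b then t.-1 else 1).
  rewrite /ladder /ladder_edge half_bit_double.
  have -> : b./2 = 0 by case: b.
  by case: b => /=; case: c; lia.
rewrite {}ladE /gkccol gkpoint_bit; last by lia.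
set y := if _ then _ else _.
have yE : y = j \/ y = n - j by rewrite /y; case: ifP; auto.
have -> : gkcol n (gkpoint b) y = if b then y.*2 %% n else y %% n.
  rewrite /gkcol /gkpoint; case: b {y yE} (y) => y /=; rewrite ?eqxx //.
  rewrite ifF; last by lia.
  by case: eqVneq => [->|//]; rewrite mod0n modnn.
case: b => /=; rewrite modn_lt2; try lia.
  by case: yE => ->; case: ltnP => ?; split; lia.
by case: yE => ->; rewrite ifT; try split; lia.
Qed.

Lemma gkccolE u v : u < t.*2 -> v < t.*2 -> u != v ->
  [/\ (gkccol u v == 0) = (u./2 == v./2),
      (gkccol u v <= 1) || (gkccol u v == n.-1) = ladder t u v
    & gkccol u v < n].
Proof.
move=> lu lv uv.
have -> : gkccol u v < n by rewrite /gkccol /gkcol; do 2?case: ifP => _; rewrite ltn_pmod //; lia.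
suff [-> ->] : (gkccol u v == 0) = (u./2 == v./2) /\
  ((gkccol u v <= 1) || (gkccol u v == n.-1) = ladder t u v) by [].
rewrite /gkccol; move: lu lv uv.
rewrite -(odd_double_half u) -(odd_double_half v).
move: (odd u) (u./2) (odd v) (v./2) => b i c j lu lv uv.
case: (posnP i) => i0; case: (posnP j) => j0.
- rewrite i0 j0 /gkpoint /gkcol /ladder /ladder_edge in uv *.
  by case: b c uv {lu lv} => [] [] //= _; rewrite ?eqxx /= ?mod0n; do ?[case: ifP => ?]; rewrite ?mod0n; split; lia.
- rewrite i0 addn0; have [/negbTE e <-] := @gkccol_end b c j ltac:(lia).
  by rewrite -/(gkccol _ _) e half_bit_double; split=> //; case: b {lu uv e}; lia.
- rewrite j0 addn0 gkcolC ladderC.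
  have [/negbTE e <-] := @gkccol_end c b i ltac:(lia).
  by rewrite -/(gkccol _ _) e half_bit_double; split=> //; case: c {lv uv e}; lia.
rewrite !gkpoint_bit // ladder_pos //; try lia.
have ij : ((b != odd i) != (c != odd j)) || (i != j).
  case: (eqVneq i j) uv => [<-|]; last by rewrite orbT.
  by rewrite eqn_add2r orbF; case: b {lu}; case: c {lv}; case: odd.
have [-> ->] := @gkccol_pos (b != odd i) (c != odd j) i j ltac:(lia) ltac:(lia) ij.
split=> //; rewrite !half_bit_double; case: (eqVneq i j) ij => [<-|//]; last by rewrite andbF.
by rewrite orbF andbT.
Qed.
End GKCodes.

(** All later constructions use GK only through these four properties. *)
Lemma gk_codes t : 1 < t -> exists col : 'I_t.*2 -> 'I_t.*2 -> nat,
  [/\ forall u v, u != v -> (col u v == 0) = (u./2 == v./2),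
      forall u v, u != v -> col u v < t.*2.-1,
      forall u v, u != v -> (col u v <= 1) || (col u v == t.*2.-2) = ladder t u v
    & forall lo j, lo + j.*2 <= t.*2.-1 -> unddec (cycp t.*2)
        (fun u v => (u != v) && (lo <= col u v < lo + j.*2) : nat) j].
Proof.
move=> t1; pose n := t.*2.-1; have nE : n.+1 = t.*2 by rewrite /n; lia.
pose f (u : 'I_t.*2) : 'I_n.+1 := Ordinal (gkpoint_lt t1 nE (ltn_ord u)).
pose g (x : 'I_n.+1) : 'I_t.*2 := Ordinal (gkcode_lt t1 nE (ltn_ord x)).
have fK : cancel f g by move=> u; apply/val_inj/(gkpointK t1 nE)/ltn_ord.
have gK : cancel g f by move=> x; apply/val_inj/(gkcodeK t1 nE)/ltn_ord.
exists (fun u v : 'I_t.*2 => gkccol n u v); split.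
- by move=> u v uv; have [] := gkccolE t1 nE (ltn_ord u) (ltn_ord v) uv.
- by move=> u v uv; have [] := gkccolE t1 nE (ltn_ord u) (ltn_ord v) uv.
- by move=> u v uv; have [_ <-] := gkccolE t1 nE (ltn_ord u) (ltn_ord v) uv.
- move=> lo j lj; have := unddec_iso_cycp fK gK (gk_interval t1 nE lj).
  by apply: eq_unddec => u v; rewrite (inj_eq (can_inj fK)).
Qed.

(** * Factors given by lists of cycles *)

Definition steps (T : Type) (s : seq T) := zip s (behead s).

Definition darcs (T : Type) (s : seq T) := zip s (rot 1 s).

Lemma count_zip (c r : seq nat) x y : uniq c -> size r = size c ->
  count_mem (x, y) (zip c r) = (x \in c) && (nth 0 r (index x c) == y) :> nat.
Proof.
elim: c r => [|z c IH] [|u r] //= /andP[zc uc] [sr]; rewrite IH // inE.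
rewrite -pair_eqE /pair_eq /= (eq_sym x); case: (eqVneq z x) => [<-|//] /=.
by rewrite (negbTE zc) addn0.
Qed.

Lemma count_darcs (c : seq nat) x y : uniq c ->
  count_mem (x, y) (darcs c) =
  (x \in c) && (nth 0 c ((index x c).+1 %% size c) == y) :> nat.
Proof.
move=> uc; rewrite count_zip ?size_rot //; case: (boolP (x \in c)) => //= xc.
congr nat_of_bool; congr (_ == _); move: xc; rewrite -index_mem.
move: (index x c) => i {uc}; case: c => // z c.
rewrite /rot /= drop0 take0 cats1 nth_rcons ltnS => lei.
case: ltnP => h; first by rewrite modn_small.
have -> : i = size c by lia.
by rewrite eqxx modnn.
Qed.

(** Every vertex lies in exactly one of the lists; the index of that list and the position in it are
    the labels fed to [perm_of_labels]. *)
Lemma cycles_perm N m (Cs : seq (seq nat)) :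
  perm_eq (flatten Cs) (iota 0 N) -> (forall c, c \in Cs -> size c = m) ->
  exists2 s : {perm 'I_N}, cycp m s &
    forall x y : 'I_N, (s x == y) = count_mem (x : nat, y : nat) (flatten (map (@darcs nat) Cs)) :> nat.
Proof.
move=> pN szm; have uF : uniq (flatten Cs) by rewrite (perm_uniq pN) iota_uniq.
have memN x : (x \in flatten Cs) = (x < N) by rewrite (perm_mem pN) mem_iota.
pose ci x := find (fun c : seq nat => x \in c) Cs; pose cy x := nth [::] Cs (ci x).
have hasx x : x < N -> has (fun c : seq nat => x \in c) Cs.
  by rewrite -memN => /flattenP[c cC xc]; apply/hasP; exists c.
have xcy x : x < N -> x \in cy x by move=> /hasx hx; apply: (nth_find [::] hx).
have cyC x : x < N -> cy x \in Cs by move=> /hasx hx; rewrite mem_nth // -has_find.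
have ucy i : uniq (nth [::] Cs i).
  elim: Cs uF i {pN szm memN ci cy hasx xcy cyC} => [|c Cs IH] /=; first by move=> _ [].
  by rewrite cat_uniq => /and3P[uc _ /IH uCs] [|i] /=.
have ciE x i : i < size Cs -> x \in nth [::] Cs i -> ci x = i.
  rewrite /ci; elim: Cs uF i {pN szm memN ci cy hasx xcy cyC ucy} => //= c Cs IH.
  rewrite cat_uniq => /and3P[_ /hasPn dj uCs] [_ -> //|i]; rewrite ltnS => li xi.
  rewrite (IH uCs i li xi) ifF //; apply/negbTE/dj.
  by apply/flattenP; exists (nth [::] Cs i); rewrite ?mem_nth.
have cntE x y : x < N -> count_mem (x, y) (flatten (map (@darcs nat) Cs)) =
    (nth 0 (cy x) ((index x (cy x)).+1 %% size (cy x)) == y).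
  move=> xN; have lx : ci x < size Cs by rewrite -has_find; apply: hasx.
  rewrite count_flatten -map_comp -(cat_take_drop (ci x) Cs) map_cat sumn_cat.
  rewrite (drop_nth [::] lx) /= -/(cy x) count_darcs; last exact: ucy.
  rewrite xcy //= (_ : sumn _ = 0); first rewrite (_ : sumn _ = 0) ?addn0 //.
  - rewrite sumnE big_map big_seq big1 // => c cD /=.
    have /(nthP [::])[i li <-] := cD; rewrite nth_drop count_darcs; last exact: ucy.
    case: (boolP (x \in _)) => //= xi; rewrite size_drop ltn_subRL in li.
    by have := ciE _ _ li xi; lia.
  - rewrite sumnE big_map big_seq big1 // => c cD /=.
    have /(nthP [::])[i li <-] := cD.
    have li' : i < ci x by move: li; rewrite size_take; case: ifP; lia.
    rewrite nth_take // count_darcs; last exact: ucy.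
    by case: (boolP (x \in _)) => //= xi; have := @ciE x i ltac:(lia) xi; lia.
pose g x := nth 0 (cy x) ((index x (cy x)).+1 %% m).
have szc x : x < N -> size (cy x) = m by move=> /cyC/szm.
have lidx x : x < N -> index x (cy x) < m by move=> xN; rewrite -(szc x xN) index_mem xcy.
have gcy x : x < N -> g x \in cy x.
  move=> xN; apply: mem_nth; rewrite szc // ltn_pmod //.
  by apply: leq_ltn_trans (lidx x xN).
have cig x : x < N -> ci (g x) = ci x.
  by move=> xN; apply: ciE (gcy x xN); rewrite -has_find; apply: hasx.
have gN x : x < N -> g x < N.
  by move=> xN; rewrite -memN; apply/flattenP; exists (cy x); [apply: cyC|apply: gcy].
pose f (x : 'I_N) := Ordinal (gN x (ltn_ord x)).
have [||||s sE cs] := @perm_of_labels _ nat m f (fun x => ci x) (fun x => index (x : nat) (cy x)).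
- by move=> x; apply: lidx.
- by move=> x; apply: cig.
- move=> x /=; have -> : cy (g x) = cy x by rewrite /cy cig.
  rewrite /g index_uniq //; last exact: ucy.
  by rewrite szc // ltn_pmod //; apply: leq_ltn_trans (lidx x (ltn_ord x)).
- move=> x y e; rewrite /cy e => exy; apply: val_inj => /=.
  rewrite -(nth_index 0 (xcy x (ltn_ord x))) -[RHS](nth_index 0 (xcy y (ltn_ord y))).
  by rewrite /cy e exy.
by exists s => // x y; rewrite cntE // szc // sE.
Qed.

(** * Cycles depending on a parameter *)

(* The code (n, c) stands for the vertex [n + c * q]. In a symbolic list [S], the
   elements of [S.2] stand for families of [q] translates with step [w]. *)
Definition affine := (nat * nat)%type.
Definition aval q (s : affine) := s.1 + s.2 * q.
Definition ev1 w q i (s : affine) := aval q s + w * i.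
Definition ev2 w q i (p : affine * affine) := (ev1 w q i p.1, ev1 w q i p.2).

Section Conc.
Variables (X Y : eqType) (E : nat -> X -> Y) (q : nat).

Definition conc (S : seq X * seq X) : seq Y :=
  map (E 0) S.1 ++ flatten [seq map (E i) S.2 | i <- iota 0 q].

Definition catS (S1 S2 : seq X * seq X) := (S1.1 ++ S2.1, S1.2 ++ S2.2).

Definition permS (S1 S2 : seq X * seq X) := perm_eq S1.1 S2.1 && perm_eq S1.2 S2.2.

Lemma count_conc a S :
  count a (conc S) = count (a \o E 0) S.1 + \sum_(0 <= i < q) count (a \o E i) S.2.
Proof.
rewrite count_cat count_map; congr addn.
rewrite count_flatten -map_comp sumnE big_map /index_iota subn0.
by apply: eq_bigr => i _ /=; rewrite count_map.
Qed.

Lemma conc_cat S1 S2 : perm_eq (conc (catS S1 S2)) (conc S1 ++ conc S2).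
Proof.
apply/seq.permP => a; rewrite count_cat !count_conc /= count_cat.
under eq_bigr do rewrite count_cat.
by rewrite big_split /=; lia.
Qed.

Lemma conc_perm S1 S2 : permS S1 S2 -> perm_eq (conc S1) (conc S2).
Proof.
case/andP => /seq.permP H1 /seq.permP H2; apply/seq.permP => a; rewrite !count_conc H1.
by congr addn; apply: eq_bigr => i _; rewrite H2.
Qed.

End Conc.

Lemma conc_map (X Y X' Y' : eqType) (E : nat -> X -> Y) (E' : nat -> X' -> Y') q h H S :
  (forall i x, E' i (h x) = H (E i x)) ->
  conc E' q (map h S.1, map h S.2) = map H (conc E q S).
Proof.
move=> EH; rewrite /conc map_cat map_flatten -!map_comp; congr (_ ++ flatten _).
  by apply: eq_map => x; rewrite /= EH.
by apply: eq_map => i /=; rewrite -!map_comp; apply: eq_map => x; rewrite /= EH.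
Qed.

Lemma steps_cat (T : Type) (x : T) s1 s2 :
  steps ((x :: s1) ++ s2) = steps (x :: s1) ++ steps (last x s1 :: s2).
Proof. by elim: s1 x => [|y s1 IH] x //=; rewrite /steps /= -IH. Qed.

Lemma steps_map (T T' : Type) (f : T -> T') s :
  steps (map f s) = [seq (f p.1, f p.2) | p <- steps s].
Proof. by case: s => // x s; elim: s x => [|y s IH] x //=; rewrite /steps /= -IH. Qed.

Definition swap (T : Type) (p : T * T) := (p.2, p.1).

Lemma steps_rev (T : Type) (s : seq T) : steps (rev s) = rev (map (@swap T) (steps s)).
Proof.
case: s => // x s; elim: s x => [|y s IH] x //.
rewrite [steps (x :: _)]/= rev_cons -[(y :: s)]/([:: y] ++ s).
have -> : rcons (rev ([:: y] ++ s)) x = rev (y :: s) ++ [:: x] by rewrite cats1.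
have [z [r e]] : exists z r, rev (y :: s) = z :: r.
  by case: (rev (y :: s)) (size_rev (y :: s)) => // z r _; exists z, r.
rewrite e steps_cat -e IH /= rev_cons -cats1; congr (_ ++ _).
have -> : last z r = y by rewrite -[LHS]/(last x (z :: r)) -e rev_cons last_rcons.
by [].
Qed.

(* [Up s o b] runs through the [q] translates of the block [o :: b] (offsets with
   respect to [s]) and ends at the next translate of [o]; [Dn] is its reverse. *)
Inductive seg := Pt of affine | Up of affine & nat & seq nat | Dn of affine & nat & seq nat.

Definition seg_code g : affine + bool * affine * nat * seq nat := match g with
  | Pt s => inl s | Up s o b => inr (true, s, o, b) | Dn s o b => inr (false, s, o, b) end.

Definition seg_decode x := match x with
  | inl s => Pt s | inr (d, s, o, b) => if d then Up s o b else Dn s o b end.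

Lemma seg_codeK : cancel seg_code seg_decode. Proof. by case. Qed.

HB.instance Definition _ := Equality.copy seg (can_type seg_codeK).

Section Segments.
Variables (w q : nat).

Fixpoint run (v o : nat) (b : seq nat) j : seq nat :=
  if j is i.+1 then run v o b i ++ [seq v + w * i + x | x <- rcons b (w + o)]
  else [:: v + o].

Definition seg_list g : seq nat := match g with
  | Pt s => [:: aval q s]
  | Up s o b => run (aval q s) o b q
  | Dn s o b => rev (run (aval q s) o b q)
  end.

Definition ash (s : affine) k : affine := (s.1 + k, s.2).

(** After [q] repetitions a run is at [o] translated by [w * q], which is why the coefficient of [q]
    grows by [w] at its upper end. *)
Definition seg_first g := match g with
  | Pt s => s | Up s o b => ash s o | Dn s o b => (s.1 + o, s.2 + w) end.

Definition seg_last g := match g with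
  | Pt s => s | Up s o b => (s.1 + o, s.2 + w) | Dn s o b => ash s o end.

Definition seg_steps g : seq (affine * affine) * seq (affine * affine) := match g with
  | Pt s => ([::], [::])
  | Up s o b => ([::], [seq (ash s p.1, ash s p.2) | p <- steps (o :: rcons b (w + o))])
  | Dn s o b => ([::], [seq (ash s p.2, ash s p.1) | p <- steps (o :: rcons b (w + o))])
  end.

Definition seg_verts g : seq affine * seq affine := match g with
  | Pt s => ([:: s], [::])
  | Up s o b | Dn s o b => ([:: (s.1 + o, s.2 + w)], [seq ash s x | x <- o :: b])
  end.

Definition seg_size g : affine := match g with
  | Pt s => (1, 0) | Up s o b | Dn s o b => (1, (size b).+1) end.

Lemma runE v o b j : exists2 r, run v o b j = (v + o) :: r & last (v + o) r = v + w * j + o.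
Proof.
elim: j => [|j [r e l]]; first by exists [::]; rewrite //= muln0 addn0.
exists (r ++ [seq v + w * j + x | x <- rcons b (w + o)]); first by rewrite /= e.
by rewrite last_cat map_rcons last_rcons mulnS; lia.
Qed.

Lemma steps_run v o b j : steps (run v o b j) =
  flatten [seq [seq (v + w * i + p.1, v + w * i + p.2) | p <- steps (o :: rcons b (w + o))]
          | i <- iota 0 j].
Proof.
elim: j => [|j IH] //; rewrite -addn1 iotaD map_cat flatten_cat -IH addn1 /= cats0.
have [r e l] := runE v o b j; rewrite e steps_cat l -e; congr (_ ++ _).
by rewrite -[v + w * j + o]/((fun x => v + w * j + x) o) -map_cons steps_map.
Qed.

Lemma perm_run v o b j : perm_eq (run v o b j)
  ((v + w * j + o) :: flatten [seq [seq v + w * i + x | x <- o :: b] | i <- iota 0 j]).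
Proof.
apply/seq.permP => a; elim: j => [|j IH]; first by rewrite /= muln0 !addn0.
rewrite -addn1 iotaD map_cat flatten_cat addn1 [run _ _ _ _]/= count_cat IH.
rewrite /= map_rcons -cats1 !count_cat /= mulnS cats0.
rewrite (_ : v + (w + w * j) + o = v + w * j + (w + o)); last by lia.
by rewrite !add0n; lia.
Qed.

Lemma seg_headE g x0 : exists2 r, seg_list g = aval q (seg_first g) :: r &
  last x0 (seg_list g) = aval q (seg_last g).
Proof.
case: g => [s|[n c] o b|[n c] o b] /=; first by exists [::].
  have [r e l] := runE (aval q (n, c)) o b q; rewrite e.
  by exists r; rewrite /= ?l /ash /aval /=; [congr cons; lia|lia].
have [r e l] := runE (aval q (n, c)) o b q.
have lr : last x0 (rev (run (aval q (n, c)) o b q)) = aval q (n, c) + o.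
  by rewrite e rev_cons last_rcons.
have : head 0 (rev (run (aval q (n, c)) o b q)) = aval q (n, c) + w * q + o.
  by rewrite -nth0 nth_rev e // subn1 /= -[size r]/(size (aval q (n, c) + o :: r)).-1 nth_last.
have : 0 < size (rev (run (aval q (n, c)) o b q)) by rewrite size_rev e.
move: lr; case: (rev _) => //= z r' lz _ zE; exists r'; last by rewrite lz /aval /=; lia.
by congr cons; rewrite zE /aval /=; lia.
Qed.

Lemma seg_stepsE g : perm_eq (steps (seg_list g)) (conc (ev2 w q) q (seg_steps g)).
Proof.
have fam s o b : steps (run (aval q s) o b q) =
    conc (ev2 w q) q ([::], [seq (ash s p.1, ash s p.2) | p <- steps (o :: rcons b (w + o))]).
  rewrite steps_run /conc /=; congr flatten; apply: eq_map => i.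
  rewrite -map_comp; apply: eq_map => p; rewrite /= /ev2 /ev1 /aval /=.
  by congr pair; lia.
case: g => [s|s o b|s o b].
- by apply/seq.permP => a; rewrite count_conc /= big1.
- by rewrite [seg_list _]/= fam perm_refl.
rewrite [seg_list _]/= steps_rev perm_rev fam.
rewrite -(@conc_map _ _ _ _ (ev2 w q) (ev2 w q) q (@swap _) (@swap _)) //=.
by rewrite -map_comp perm_refl.
Qed.

Lemma seg_vertsE g : perm_eq (seg_list g) (conc (ev1 w q) q (seg_verts g)).
Proof.
have fam s o b : perm_eq (run (aval q s) o b q)
    (conc (ev1 w q) q ([:: (s.1 + o, s.2 + w)], [seq ash s x | x <- o :: b])).
  apply: perm_trans (perm_run _ _ _ _) _; rewrite /conc [_.1]/= [_.2]/= [map _ [:: _]]/=.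
  rewrite cat1s (_ : ev1 _ _ _ _ = aval q s + w * q + o); last by rewrite /ev1 /aval /=; lia.
  rewrite perm_cons (eq_map (g := fun i => map (ev1 w q i) [seq ash s x | x <- o :: b])) //.
  move=> i; rewrite -map_comp; apply: eq_map => x; rewrite /= /ev1 /aval /=; lia.
case: g => [s|s o b|s o b]; first 2 last.
- by rewrite [seg_list _]/= perm_rev fam.
- apply/seq.permP => a; rewrite count_conc /= big1 //.
  by rewrite /ev1 muln0 !addn0.
- exact: fam.
Qed.

Lemma seg_sizeE g : size (seg_list g) = aval q (seg_size g).
Proof.
have fam v o b j : size (run v o b j) = 1 + (size b).+1 * j.
  by elim: j => [|j IH] /=; rewrite ?muln0 // size_cat IH size_map size_rcons; lia.
by case: g => [s|s o b|s o b] /=; rewrite ?size_rev ?fam.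
Qed.

Definition cyc_list (c : seq seg) := flatten (map seg_list c).

Definition sumS (X : eqType) (L : seq (seq X * seq X)) := foldr (@catS X) ([::], [::]) L.

Definition cyc_arcs (c : seq seg) :=
  catS (zip (map seg_last c) (rot 1 (map seg_first c)), [::]) (sumS (map seg_steps c)).

Definition cyc_verts (c : seq seg) := sumS (map seg_verts c).

Definition cyc_size (c : seq seg) : affine :=
  (sumn [seq (seg_size g).1 | g <- c], sumn [seq (seg_size g).2 | g <- c]).

Lemma conc_sumS (X Y : eqType) (E : nat -> X -> Y) L :
  perm_eq (conc E q (sumS L)) (flatten (map (conc E q) L)).
Proof.
elim: L => [|S L IH] /=; first by apply/seq.permP => a; rewrite count_conc /= big1.
by apply: perm_trans (conc_cat _ _ _ _) _; rewrite perm_cat2l.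
Qed.

Lemma steps_cyc g c : perm_eq (steps (cyc_list (g :: c)))
  (zip (map (aval q \o seg_last) (g :: c)) (map (aval q \o seg_first) c) ++
   flatten (map (steps (T := nat) \o seg_list) (g :: c))).
Proof.
elim: c g => [|h c IH] g; first by rewrite /cyc_list /= !cats0 perm_refl.
have -> : cyc_list [:: g, h & c] = seg_list g ++ cyc_list (h :: c) by [].
have [r e l] := seg_headE g 0; have [r' e' _] := seg_headE h 0.
have hE : cyc_list (h :: c) = aval q (seg_first h) :: (r' ++ cyc_list c).
  by rewrite /cyc_list /= e'.
have -> : steps (seg_list g ++ cyc_list (h :: c)) =
    steps (seg_list g) ++ (aval q (seg_last g), aval q (seg_first h)) :: steps (cyc_list (h :: c)).
  by rewrite hE e steps_cat -l e.
apply/seq.permP => a; have /seq.permP/(_ a) H := IH h.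
rewrite count_cat [count a (_ :: steps _)]/= {}H.
by rewrite !count_cat !map_cons /= ?count_cat; lia.
Qed.

Lemma darcs_steps (T : Type) (x : T) s : darcs (x :: s) = rcons (steps (x :: s)) (last x s, x).
Proof.
have H z : forall u, zip (u :: s) (rcons s z) = rcons (zip (u :: s) s) (last u s, z).
  by elim: s => [|y s IH] u //=; rewrite -IH.
by rewrite /darcs rot1_cons H.
Qed.

(** Cutting the closed list at the segment boundaries leaves the arcs inside the runs, which come in
    families, and one joining arc per boundary; the closing arc joins the last segment to the
    first. *)
Lemma cyc_arcsE c : 0 < size c ->
  perm_eq (darcs (cyc_list c)) (conc (ev2 w q) q (cyc_arcs c)).
Proof.
case: c => // g c _; have [r e l] := seg_headE g 0.
have hE : cyc_list (g :: c) = aval q (seg_first g) :: (r ++ cyc_list c).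
  by rewrite /cyc_list /= e.
have lE : last (aval q (seg_first g)) (r ++ cyc_list c) = aval q (seg_last (last g c)).
  rewrite -[LHS]/(last 0 (aval q (seg_first g) :: (r ++ cyc_list c))) -hE {hE e l}.
  elim: c g {r} => [|h c IH] g; rewrite /cyc_list /= ?cats0.
    by have [r _ ->] := seg_headE g 0.
  by rewrite last_cat -/(cyc_list (h :: c)) -IH; have [r' e' _] := seg_headE h 0;
    rewrite /cyc_list /= e'.
rewrite hE darcs_steps lE -hE.
apply: perm_trans (_ : perm_eq _ (_ :: steps (cyc_list (g :: c)))) _.
  by rewrite perm_rcons.
apply/seq.permP => a; rewrite /cyc_arcs.
have /seq.permP -> := conc_cat (ev2 w q) q
   (zip (map seg_last (g :: c)) (rot 1 (map seg_first (g :: c))), [::]) (sumS (map seg_steps (g :: c))).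
rewrite count_cat; have /seq.permP -> := conc_sumS (ev2 w q) (map seg_steps (g :: c)).
have /seq.permP H := steps_cyc g c; rewrite [count _ (_ :: _)]/= H count_cat addnA; congr addn.
  rewrite count_conc [\sum_(_ <= _ < _) _]big1 // addn0.
  have E u : ev1 w q 0 u = aval q u by rewrite /ev1 muln0 addn0.
  have : forall s0 h, a (aval q (seg_last (last h c)), aval q s0) +
      count a (zip (map (aval q \o seg_last) (h :: c)) (map (aval q \o seg_first) c)) =
    count (a \o ev2 w q 0) (zip (map seg_last (h :: c)) (rcons (map seg_first c) s0)).
    move=> s0; elim: (c) => [|h c' IH] k; first by rewrite /= /ev2 !E.
    by rewrite !map_cons rcons_cons /= -(IH h) /ev2 !E /=; lia.
  by move=> ->; rewrite map_cons rot1_cons.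
rewrite -map_comp !count_flatten -!map_comp; congr sumn; apply: eq_map => h /=.
by have /seq.permP -> := seg_stepsE h.
Qed.

Lemma cyc_vertsE c : perm_eq (cyc_list c) (conc (ev1 w q) q (cyc_verts c)).
Proof.
rewrite perm_sym; apply: perm_trans (conc_sumS _ _) _; rewrite -map_comp.
apply/seq.permP => a; rewrite !count_flatten -!map_comp; congr sumn; apply: eq_map => h /=.
by have /seq.permP -> := seg_vertsE h.
Qed.

Lemma cyc_sizeE c : size (cyc_list c) = aval q (cyc_size c).
Proof.
rewrite /cyc_list /cyc_size /aval /=; elim: c => //= g c IH.
by rewrite size_cat IH seg_sizeE /aval mulnDl; lia.
Qed.

End Segments.

(** * Symbolic verification of decompositions *)

Section Strip.
Variables (w q N : nat).

Definition fac_arcs (f : seq (seq seg)) := sumS (map (cyc_arcs w) f).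
Definition fac_verts (f : seq (seq seg)) := sumS (map (cyc_verts w) f).
Definition swapS (X : Type) (S : seq (X * X) * seq (X * X)) :=
  (map (@swap X) S.1, map (@swap X) S.2).
Definition fac_edges f := catS (fac_arcs f) (swapS (fac_arcs f)).

Definition good_fac ms V f :=
  permS (fac_verts f) V && all (fun c => cyc_size c == ms) f.

(** The number [q] of repetitions does not occur, so one computation serves for all [q]. [D] lists
    directed factors and [U] undirected ones; a positive [ms.1] excludes empty cycles. *)
Definition strip_check (ms : affine) V D U G :=
  [&& 0 < ms.1, all (good_fac ms V) (D ++ U)
    & permS (catS (sumS (map fac_arcs D)) (sumS (map fac_edges U))) G].

Definition arcmul S (x y : 'I_N) := count_mem (x : nat, y : nat) (conc (ev2 w q) q S).

Lemma count_swap x y S :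
  count_mem (x, y) (conc (ev2 w q) q (swapS S)) = count_mem (y, x) (conc (ev2 w q) q S).
Proof.
rewrite (@conc_map _ _ _ _ (ev2 w q) (ev2 w q) q (@swap _) (@swap _)) // count_map.
by apply: eq_count => -[a b] /=; rewrite /swap -!pair_eqE /pair_eq /= andbC.
Qed.

Lemma fac_perm ms V f m : 0 < ms.1 -> good_fac ms V f -> aval q ms = m ->
  perm_eq (conc (ev1 w q) q V) (iota 0 N) ->
  exists2 s : {perm 'I_N}, cycp m s &
    forall x y, (s x == y) = arcmul (fac_arcs f) x y :> nat.
Proof.
move=> ms0 /andP[pV /allP szf] qm VN.
have pF : perm_eq (flatten (map (cyc_list w q) f)) (iota 0 N).
  apply: perm_trans VN; apply: perm_trans (conc_perm (ev1 w q) q pV).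
  rewrite perm_sym; apply: perm_trans (conc_sumS _ _ _) _; rewrite -map_comp.
  apply/seq.permP => a; rewrite !count_flatten -!map_comp; congr sumn; apply: eq_map => c /=.
  by have /seq.permP -> := cyc_vertsE w q c.
have [|s cs Hs] := @cycles_perm N m (map (cyc_list w q) f) pF.
  by move=> _ /mapP[c cf ->]; rewrite cyc_sizeE (eqP (szf c cf)).
exists s => // x y; rewrite Hs /arcmul.
have /seq.permP -> := conc_sumS q (ev2 w q) (map (cyc_arcs w) f).
rewrite !count_flatten -!map_comp; congr sumn; apply/eq_in_map => c cf /=.
have c0 : 0 < size c.
  by case: c cf => // /szf/eqP e; rewrite -e in ms0.
by have /seq.permP -> := cyc_arcsE w q c0.
Qed.

Lemma arcmul_cat S1 S2 x y : arcmul (catS S1 S2) x y = arcmul S1 x y + arcmul S2 x y.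
Proof. by rewrite /arcmul -count_cat; apply/seq.permP/conc_cat. Qed.

Lemma arcmul_nil x y : arcmul ([::], [::]) x y = 0.
Proof. by rewrite /arcmul count_conc /= big1. Qed.

Lemma arcmul_swap S x y : arcmul (swapS S) x y = arcmul S y x.
Proof. exact: count_swap. Qed.

Lemma strip_dec ms V D U G m : strip_check ms V D U G -> aval q ms = m ->
  perm_eq (conc (ev1 w q) q V) (iota 0 N) ->
  sol m (arcmul G) 0 (size D) (size U).
Proof.
case/and3P => ms0; rewrite all_cat => /andP[/allP gD /allP gU] pG qm VN.
have perm_of f : good_fac ms V f -> _ := fun gf => fac_perm ms0 gf qm VN.
exists (fun _ _ => 0), (arcmul (sumS (map fac_arcs D))), (arcmul (sumS (map fac_edges U))).
split.
- exact: dirdec0.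
- elim: D gD {pG} => [|f D IH] gD.
    by apply: (@eq_dirdec _ _ (fun _ _ => 0)); [move=> x y; rewrite arcmul_nil | exact: dirdec0].
  have [s cs Hs] := perm_of f (gD f (mem_head _ _)).
  have [L [sL PL HL]] := IH (fun g gg => gD g (mem_behead (s := f :: D) gg)).
  exists (s :: L); split; first by rewrite /= sL.
    by move=> u; rewrite inE => /orP[/eqP ->|/PL].
  by move=> x y; rewrite /mulp /= Hs -[count _ _]/(mulp L x y) HL arcmul_cat.
- elim: U gU {pG} => [|f U IH] gU.
    by apply: (@eq_unddec _ _ (fun _ _ => 0)); [move=> x y; rewrite arcmul_nil | exact: unddec0].
  have [s cs Hs] := perm_of f (gU f (mem_head _ _)).
  have [L [sL PL HL]] := IH (fun g gg => gU g (mem_behead (s := f :: U) gg)).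
  exists (s :: L); split; first by rewrite /= sL.
    by move=> u; rewrite inE => /orP[/eqP ->|/PL].
  move=> x y; rewrite /= !arcmul_cat -HL arcmul_swap -!Hs.
  by rewrite /mulp /= addnACA.
- move=> x y; rewrite add0n -arcmul_cat; apply/seq.permP; exact: conc_perm.
Qed.

End Strip.

(** * The doubled ladder *)

(** A symbolic interval starting at [n + c * q]; passing a repeated block moves the start by
    [w * q], hence [c + w]. *)
Fixpoint siota w n c (parts : seq (option nat)) : seq affine * seq affine :=
  match parts with
  | [::] => ([::], [::])
  | Some l :: r => catS ([seq (n + i, c) | i <- iota 0 l], [::]) (siota w (n + l) c r)
  | None :: r => catS ([::], [seq (n + i, c) | i <- iota 0 w]) (siota w n (c + w) r)
  end.

Definition parts_size w (parts : seq (option nat)) : affine :=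
  (sumn (pmap id parts), w * count (fun p => p == None) parts).

Lemma siotaE w q n c parts :
  perm_eq (conc (ev1 w q) q (siota w n c parts))
          (iota (n + c * q) (aval q (parts_size w parts))).
Proof.
elim: parts n c => [|[l|] parts IH] n c /=.
- rewrite /parts_size /aval /= muln0 /=; apply/seq.permP => a; rewrite count_conc /= big1 //.
- apply: perm_trans (conc_cat _ _ _ _) _.
  rewrite (_ : aval _ _ = l + aval q (parts_size w parts)); last first.
    by rewrite /aval /parts_size /= addnA.
  rewrite iotaD; apply: perm_cat; last first.
    by rewrite (_ : n + c * q + l = n + l + c * q) //; lia.
  rewrite /conc /= (_ : flatten _ = [::]); last by elim: (iota 0 q).
  rewrite cats0 -[n + c * q]addn0 iotaDl -map_comp.
  by rewrite (eq_map (g := addn (n + c * q))) // => i; rewrite /= /ev1 /aval /=; lia.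
apply: perm_trans (conc_cat _ _ _ _) _.
rewrite (_ : aval _ _ = w * q + aval q (parts_size w parts)); last first.
  by rewrite /aval /parts_size /=; lia.
rewrite iotaD; apply: perm_cat; last first.
  by rewrite (_ : n + c * q + w * q = n + (c + w) * q) //; lia.
have E i : map (ev1 w q i) [seq (n + i, c) | i <- iota 0 w] = iota (n + c * q + w * i) w.
  rewrite -map_comp -[n + c * q + w * i]addn0 iotaDl.
  by apply: eq_map => j; rewrite /= /ev1 /aval /=; lia.
rewrite /conc /= (eq_map E); move: (n + c * q) => v.
elim: (q) => [|k]; first by rewrite muln0.
rewrite -[k.+1]addn1 iotaD map_cat flatten_cat /= cats0 add0n (mulnDr w k 1) muln1 iotaD => H.
by apply: perm_cat.
Qed.

Definition afmap k a (s : affine) : affine := (k * s.1 + a, k * s.2).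
Definition edgeS k a b (S : seq affine * seq affine) :=
  (map (fun s => (afmap k a s, afmap k b s)) S.1, map (fun s => (afmap k a s, afmap k b s)) S.2).
Definition blow1 a b (S : seq (affine * affine) * seq (affine * affine)) :=
  (map (fun p => (afmap 2 a p.1, afmap 2 b p.2)) S.1, map (fun p => (afmap 2 a p.1, afmap 2 b p.2)) S.2).
(** The vertex [x] becomes the independent pair [2 * x], [2 * x + 1], so each arc becomes four. *)
Definition blow S := catS (catS (blow1 0 0 S) (blow1 0 1 S)) (catS (blow1 1 0 S) (blow1 1 1 S)).

Lemma conc_edgeS k a b w q S : conc (ev2 (k * w) q) q (edgeS k a b S) =
  [seq (k * x + a, k * x + b) | x <- conc (ev1 w q) q S].
Proof.
apply: conc_map => i [n c]; rewrite /ev2 /ev1 /aval /afmap /=.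
by congr pair; rewrite !mulnDr !mulnA; lia.
Qed.

Lemma conc_blow1 a b w q S : conc (ev2 (2 * w) q) q (blow1 a b S) =
  [seq (2 * p.1 + a, 2 * p.2 + b) | p <- conc (ev2 w q) q S].
Proof.
apply: conc_map => i [[n c] [n' c']]; rewrite /ev2 /ev1 /aval /afmap /=.
by congr pair; rewrite !mulnDr !mulnA; lia.
Qed.

Lemma count_blow w q S x y :
  count_mem (x, y) (conc (ev2 (2 * w) q) q (blow S)) =
  count_mem (x./2, y./2) (conc (ev2 w q) q S).
Proof.
have E a b : a < 2 -> b < 2 ->
    count_mem (x, y) (conc (ev2 (2 * w) q) q (blow1 a b S)) =
    ((odd x == a :> nat) && (odd y == b :> nat)) * count_mem (x./2, y./2) (conc (ev2 w q) q S).
  move=> la lb; rewrite conc_blow1 count_map.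
  transitivity (count (fun p => ((odd x == a :> nat) && (odd y == b :> nat)) &&
      (p == (x./2, y./2))) (conc (ev2 w q) q S)); last first.
    by case: (_ && _) => /=; rewrite ?mul1n ?mul0n //; elim: (conc _ _ _).
  apply: eq_count => -[u v] /=; rewrite -!pair_eqE /pair_eq /=.
  have := odd_double_half x; have := odd_double_half y.
  by move: (odd x) (x./2) (odd y) (y./2) => ox x2 oy y2; case: ox; case: oy; lia.
have C S1 S2 a : count a (conc (ev2 (2 * w) q) q (catS S1 S2)) =
  count a (conc (ev2 (2 * w) q) q S1) + count a (conc (ev2 (2 * w) q) q S2).
  by have /seq.permP -> := conc_cat (ev2 (2 * w) q) q S1 S2; rewrite count_cat.
by rewrite /blow !C !E //; case: odd; case: odd; lia.
Qed.

Lemma arcmul_blow w q N S (x y : 'I_N) : arcmul (2 * w) q (blow S) x y =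
  count_mem (x./2, y./2) (conc (ev2 w q) q S).
Proof. exact: count_blow. Qed.

Lemma count_sel (P : pred nat) (c : bool) i0 s : uniq s ->
  (forall i, P i = c && (i == i0)) -> count P s = c && (i0 \in s) :> nat.
Proof.
move=> us PE; rewrite (eq_count PE); case: c {PE} => /=; last by elim: s {us}.
by rewrite -(count_uniq_mem _ us).
Qed.

(* [parts] describes the columns between the first [l0.+1] and the last [l1.+1]
   ones: [Some l] stands for [l] columns and [None] for a block of
   [wc] columns repeated [q] times. *)
Section LadderGraph.
Variables (wc l0 : nat) (parts : seq (option nat)) (l1 : nat).

Let ends a b := Some a :: rcons parts (Some b).
Let dbl := map (omap double).

Definition ladder_t : affine := parts_size wc (ends l0.+1 l1.+1).

(** In order: rungs, rails, and the four edges at the apices. No rail starts in column 0 or in the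
    last column, so the end parts of the rails have one column fewer, [l0] and [l1], and the
    repeated windows stay aligned. *)
Definition ladder_edgeS :=
  catS (edgeS 2 0 1 (siota wc 0 0 (ends l0.+1 l1.+1)))
  (catS (edgeS 1 0 2 (siota (2 * wc) 2 0 (dbl (ends l0 l1))))
   ([:: ((0, 0), (2, 0)); ((0, 0), (3, 0));
        ((1, 0), ((2 * ladder_t.1).-2, 2 * ladder_t.2));
        ((1, 0), ((2 * ladder_t.1).-1, 2 * ladder_t.2))], [::])).

Definition ladder_graphS (withI : bool) :=
  let E := catS (blow ladder_edgeS)
    (if withI then edgeS 2 0 1 (siota (2 * wc) 0 0 (dbl (ends l0.+1 l1.+1))) else ([::], [::])) in
  catS E (swapS E).

Definition ladder_vertsS := siota (2 * (2 * wc)) 0 0 (dbl (dbl (ends l0.+1 l1.+1))).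

Lemma ladder_t_ge2 : 1 < ladder_t.1.
Proof. by rewrite /ladder_t /parts_size /ends -cats1 /= pmap_cat sumn_cat /=; lia. Qed.

Variables (q t : nat).
Hypothesis tE : t = aval q ladder_t.

Let sumn_dbl p : sumn (pmap id (dbl p)) = (sumn (pmap id p)).*2.
Proof. by elim: p => //= -[l|] p IH //=; rewrite IH doubleD. Qed.

Let count_dbl p : count (fun x => x == None) (dbl p) = count (fun x => x == None) p.
Proof. by elim: p => //= -[l|] p IH //=; rewrite IH. Qed.

Let psize_dbl w p : aval q (parts_size (2 * w) (dbl p)) = (aval q (parts_size w p)).*2.
Proof. by rewrite /parts_size /aval /= sumn_dbl count_dbl -!mul2n mulnDr !mulnA. Qed.

Let psize_ends w a b : aval q (parts_size w (ends a b)) = a + b + aval q (parts_size w parts).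
Proof.
rewrite /parts_size /aval /ends -cats1 /= pmap_cat count_cat sumn_cat /=; lia.
Qed.

Let t_gt1 : 1 < t.
Proof. by rewrite tE /aval; have := ladder_t_ge2; lia. Qed.

Lemma ladder_edgeSE x y : x < t.*2 -> y < t.*2 ->
  count_mem (x, y) (conc (ev2 (2 * wc) q) q ladder_edgeS) = ladder_edge t x y.
Proof.
move=> xt yt; have C S1 S2 a : count a (conc (ev2 (2 * wc) q) q (catS S1 S2)) =
  count a (conc (ev2 (2 * wc) q) q S1) + count a (conc (ev2 (2 * wc) q) q S2).
  by have /seq.permP -> := conc_cat (ev2 (2 * wc) q) q S1 S2; rewrite count_cat.
have ho := odd_double_half x.
have rungs : count_mem (x, y)
    (conc (ev2 (2 * wc) q) q (edgeS 2 0 1 (siota wc 0 0 (ends l0.+1 l1.+1)))) =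
    (~~ odd x && (y == x.+1)) && (x./2 < t).
  rewrite conc_edgeS count_map.
  have /seq.permP -> := siotaE wc q 0 0 (ends l0.+1 l1.+1).
  rewrite -/ladder_t -tE (@count_sel _ (~~ odd x && (y == x.+1)) x./2) ?iota_uniq ?mem_iota //.
  move=> i /=; rewrite -pair_eqE /pair_eq /=; move: ho.
  by move: (odd x) (x./2) => o h; case: o; lia.
have rails : count_mem (x, y)
    (conc (ev2 (2 * wc) q) q (edgeS 1 0 2 (siota (2 * wc) 2 0 (dbl (ends l0 l1))))) =
    (y == x.+2) && (2 <= x < 2 + (t - 2).*2).
  have := conc_edgeS 1 0 2 (2 * wc) q (siota (2 * wc) 2 0 (dbl (ends l0 l1))).
  rewrite mul1n => ->; rewrite count_map.
  have /seq.permP -> := siotaE (2 * wc) q 2 0 (dbl (ends l0 l1)).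
  have tE2 : aval q (parts_size wc (ends l0 l1)) = t - 2.
    by rewrite tE /ladder_t !psize_ends; lia.
  rewrite psize_dbl tE2 (@count_sel _ (y == x.+2) x) ?iota_uniq ?mem_iota //.
  by move=> i /=; rewrite -pair_eqE /pair_eq /=; lia.
rewrite /ladder_edgeS !C rungs rails count_conc /= big1 // addn0.
rewrite /ladder_edge /ev2 /ev1 /aval /= !muln0 !addn0 !add0n -!pair_eqE /pair_eq /=.
have -> : (2 * ladder_t.1).-2 + 2 * ladder_t.2 * q = t.*2.-2.
  by rewrite tE /aval; have := ladder_t_ge2; lia.
have -> : (2 * ladder_t.1).-1 + 2 * ladder_t.2 * q = t.*2.-1.
  by rewrite tE /aval; have := ladder_t_ge2; lia.
have -> : (x./2 == y./2) && (x < y) = ~~ odd x && (y == x.+1).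
  have := odd_double_half y; move: ho.
  by move: (odd x) (x./2) (odd y) (y./2) => [] x2 [] y2; lia.
have -> : x./2 < t by rewrite ltn_half_double.
rewrite andbT; move: xt yt t_gt1 => {ho rungs rails C}; move: (t) => t'.
case: x => [|[|x]] /= xt yt t1.
- by rewrite !andbF !orbF; case: y yt => [|[|[|[|y]]]].
- rewrite !andbF /= !(eq_sym _ y); case: (eqVneq y t'.*2.-2) => [->|_] //=.
  by rewrite (_ : (_ == _) = false); lia.
- rewrite !addn0 orbF; case: (eqVneq y x.+4) yt => [->|_] yt /=; last by rewrite addn0 orbF.
  by rewrite (_ : (x.+4 == x.+3) = false) ?andbF; lia.
Qed.

Lemma ladder_vertsSE : perm_eq (conc (ev1 (2 * (2 * wc)) q) q ladder_vertsS) (iota 0 t.*2.*2).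
Proof.
have := siotaE (2 * (2 * wc)) q 0 0 (dbl (dbl (ends l0.+1 l1.+1))).
by rewrite !psize_dbl -/ladder_t -tE.
Qed.

Lemma ladder_graphSE b (x y : 'I_t.*2.*2) : arcmul (2 * (2 * wc)) q (ladder_graphS b) x y =
  ladder t x./2 y./2 + (b && ((x != y) && (x./2 == y./2))).
Proof.
have lx : x./2 < t.*2 by rewrite ltn_half_double.
have ly : y./2 < t.*2 by rewrite ltn_half_double.
rewrite /ladder_graphS arcmul_cat arcmul_swap; do 2!rewrite [arcmul _ _ (catS (blow _) _) _ _]arcmul_cat; rewrite !arcmul_blow !ladder_edgeSE //.
have IE (u v : 'I_t.*2.*2) : arcmul (2 * (2 * wc)) q
    (if b then edgeS 2 0 1 (siota (2 * wc) 0 0 (dbl (ends l0.+1 l1.+1))) else ([::], [::])) u v =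
    b && (~~ odd u && (v == u.+1 :> nat)).
  case: b; last by rewrite arcmul_nil.
  rewrite /arcmul conc_edgeS count_map.
  have /seq.permP -> := siotaE (2 * wc) q 0 0 (dbl (ends l0.+1 l1.+1)).
  rewrite psize_dbl -/ladder_t -tE.
  rewrite (@count_sel _ (~~ odd u && (v == u.+1 :> nat)) u./2) ?iota_uniq //; last first.
    move=> i /=; rewrite -pair_eqE /pair_eq /=; have := odd_double_half u.
    by move: (odd u) (u./2) => o h; case: o; lia.
  by rewrite mem_iota /= (_ : _ < _) ?andbT // ltn_half_double.
have lt u v : u < t.*2 -> v < t.*2 -> ladder_edge t u v -> u < v.
  by rewrite /ladder_edge; case: (u) => [|[|u']] /=; lia.
have -> : ladder t x./2 y./2 = ladder_edge t x./2 y./2 + ladder_edge t y./2 x./2 :> nat.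
  rewrite /ladder; case: (boolP (ladder_edge t x./2 y./2)) => [/(lt _ _ lx ly) h|] //=.
  by case: (boolP (ladder_edge t y./2 x./2)) => // /(lt _ _ ly lx); lia.
rewrite !IE addnACA; congr addn; case: b {IE} => //=; rewrite -(inj_eq val_inj) /=.
have := odd_double_half x; have := odd_double_half y.
by move: (odd x) (x./2) (odd y) (y./2) => [] x2 [] y2 <- <-; lia.
Qed.

End LadderGraph.

(** * Blocks and the edges between them *)

Definition complete_sol (T : finType) m r s c :=
  sol m (fun x y : T => x != y : nat) r s c.

Lemma complete_sol_card (T T' : finType) m r s c : #|T| = #|T'| ->
  complete_sol T m r s c -> complete_sol T' m r s c.
Proof.
move=> eT; pose f (x : T') : T := enum_val (cast_ord (esym eT) (enum_rank x)).
pose g (x : T) : T' := enum_val (cast_ord eT (enum_rank x)).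
have fK : cancel f g by move=> x; rewrite /g enum_valK cast_ordKV enum_rankK.
have gK : cancel g f by move=> x; rewrite /f enum_valK cast_ordK enum_rankK.
move=> /(sol_iso fK gK); apply: eq_sol => x y.
by rewrite (inj_eq (can_inj fK)).
Qed.

Lemma unddec_mono (T : finType) (P P' : {perm T} -> Prop) w k :
  (forall s, P s -> P' s) -> unddec P w k -> unddec P' w k.
Proof. by move=> H [L [sL PL HL]]; exists L; split=> // s /PL/H. Qed.

Lemma sol_unddec (T : finType) m w c : unddec (cycp m) w c -> @sol T m w 0 0 c.
Proof.
by move=> H; exists (fun _ _ => 0), (fun _ _ => 0), w; split=> //; exact: dirdec0.
Qed.

Lemma sol_add (T : finType) m (w w' : T -> T -> nat) r s c r' s' c' :
  sol m w r s c -> sol m w' r' s' c' ->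
  sol m (fun x y => w x y + w' x y) (r + r') (s + s') (c + c').
Proof.
move=> [w1 [w2 [w3 [H1 H2 H3 H]]]] [w1' [w2' [w3' [H1' H2' H3' H']]]].
exists (fun x y => w1 x y + w1' x y), (fun x y => w2 x y + w2' x y).
exists (fun x y => w3 x y + w3' x y); split; try exact: dirdecD; first exact: unddecD.
by move=> x y; rewrite -H -H'; lia.
Qed.

Section Halves.
Variable n : nat.

Definition half_ord (u : 'I_n.*2) : 'I_n :=
  Ordinal (etrans (ltn_half_double u n) (ltn_ord u)).

Lemma bit_lt (i : 'I_n) (b : bool) : b + i.*2 < n.*2.
Proof. by have := ltn_ord i; case: b; lia. Qed.

Definition split_ord (u : 'I_n.*2) := (half_ord u, odd u).
Definition join_ord (p : 'I_n * bool) : 'I_n.*2 := Ordinal (bit_lt p.1 p.2).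

Lemma split_ordK : cancel split_ord join_ord.
Proof. by move=> u; apply: val_inj; rewrite /= odd_double_half. Qed.

Lemma join_ordK : cancel join_ord split_ord.
Proof.
move=> [i b]; rewrite /split_ord /= oddD odd_double addbF oddb; congr pair.
by apply: val_inj; rewrite /= half_bit_double.
Qed.

Lemma sol_halves m : sol m (fun u v : 'I_n.*2 => (u != v) && (u./2 == v./2) : nat) 1 0 0.
Proof.
pose w (u v : 'I_n * bool) : nat := (u != v) && (u.1 == v.1).
have fI : involutive (fun u : 'I_n * bool => (u.1, ~~ u.2)).
  by move=> [i b]; rewrite /= negbK.
have : sol m w 1 0 0.
  exists w, (fun _ _ => 0), (fun _ _ => 0); split; [|exact: dirdec0|exact: unddec0|].
    exists [:: perm (inv_inj fI)]; split=> // [s|[i a] [j b]].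
      rewrite inE => /eqP ->; apply: cycp2P => x; rewrite !permE ?fI //.
      by case: x => i []; rewrite -pair_eqE /pair_eq /= andbF.
    rewrite /mulp /w /= permE -!pair_eqE /pair_eq /= addn0.
    by case: eqVneq; case: a; case: b.
  by move=> x y; rewrite !addn0.
move=> /(sol_iso split_ordK join_ordK); apply: eq_sol => u v.
by rewrite /w (inj_eq (can_inj split_ordK)) -val_eqE.
Qed.

Lemma haggkvist_ord k w c : 1 < k -> unddec (labp k) (w : 'I_n -> 'I_n -> nat) c ->
  unddec (cycp k.*2) (fun u v : 'I_n.*2 => w (half_ord u) (half_ord v)) (c * 2).
Proof.
move=> k1 H; have := unddec_bind (p := @fst _ bool) (fun s => haggkvist k1 (s := s)) H.
by move=> /(unddec_iso_cycp split_ordK join_ordK).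
Qed.

End Halves.

(** Colour 0 is the K_2^*-factor; the other [2 * t - 2] colours pair up into Hamiltonian cycles. *)
Lemma complete_even_cycles t : 1 < t -> complete_sol 'I_t.*2 t.*2 1 0 t.-1.
Proof.
move=> t1; have [col [c0 clt _ H]] := gk_codes t1.
have := sol_add (sol_halves t t.*2) (sol_unddec (H 1 t.-1 ltac:(lia))).
apply: eq_sol => u v; case: (eqVneq u v) => //= uv.
by have := c0 u v uv; have := clt u v uv; lia.
Qed.

Lemma complete_ladder t k (b : bool) d u : 1 < t -> 1 < k -> k %| t.*2 ->
  sol k.*2 (fun x y : 'I_t.*2.*2 =>
    ladder t x./2 y./2 + (b && ((x != y) && (x./2 == y./2)))) 0 d u ->
  complete_sol 'I_t.*2.*2 k.*2 (~~ b) d (u + (t - 2) * 2).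
Proof.
move=> t1 k1 kt S; have [col [c0 clt cl H]] := gk_codes t1.
(* The colours 2 to [2 * t - 3] lie outside the ladder. Their Hamiltonian cycles have length
   [2 * t], a multiple of [k], so they carry labels modulo [k]. *)
have R : unddec (labp k) (fun u v : 'I_t.*2 => (u != v) && (2 <= col u v < 2 + (t - 2).*2) : nat) (t - 2).
  apply: unddec_mono (H 2 (t - 2) ltac:(lia)) => s cs; apply: labp_dvd kt _.
  by apply: cycp_labp cs; lia.
have := sol_add S (sol_unddec (haggkvist_ord k1 R)).
have I : sol k.*2 (fun x y : 'I_t.*2.*2 => ~~ b && ((x != y) && (x./2 == y./2)) : nat) (~~ b) 0 0.
  case: b {S} => /=; last exact: sol_halves.
  by apply: sol_unddec; exact: unddec0.
move=> /(sol_add I); rewrite !addn0 !add0n; apply: eq_sol => x y.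
have lE (x' y' : 'I_t.*2.*2) : (half_ord x' == half_ord y') = (x'./2 == y'./2) by [].
have lad0 i : ladder t i i = false.
  by rewrite /ladder orbb /ladder_edge ltnn andbF; lia.
case: (eqVneq x y) => [->|xy] /=.
  by rewrite lad0 !andbF eqxx.
rewrite lE; case: (eqVneq x./2 y./2) => [->|h] /=.
  by rewrite lad0; case: b {S I}.
have hh : half_ord x != half_ord y by [].
have := c0 _ _ hh; have := clt _ _ hh; have := cl _ _ hh; rewrite /= !andbF.
move: (col _ _) (ladder _ _ _) => g l; lia.
Qed.

(** The factors of the fibre [bool * 'I_p * bool] are three successive blow-ups: the first turns K_j
    into K_2j without colour 0, the second is the cyclic lift, the third is Haggkvist's doubling. *)
Lemma cross_unddec j p k : 0 < j -> 1 < k -> k %| p.*2 ->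
  unddec (cycp k.*2)
    (fun u v : 'I_j * (bool * 'I_p * bool) => u.1 != v.1 : nat) (j.-1 * p * 2).
Proof.
(* A single block has no outside edges, and GK needs [1 < j]. *)
move=> j0 k1 kp; have [->|j1] : j = 1 \/ 1 < j by lia.
  apply: (@eq_unddec _ _ (fun _ _ => 0)); last by rewrite !mul0n; exact: unddec0.
  by move=> [[i li] x] [[i' li'] y] /=; rewrite -val_eqE /=; lia.
have [col [c0 clt _ H]] := gk_codes j1.
have G : unddec (labp 2) (fun u v : 'I_j.*2 => (u./2 != v./2) : nat) j.-1.
  have := H 1 j.-1 ltac:(lia).
  move=> /(unddec_mono (P' := labp 2)) R; apply: eq_unddec (R _) => [u v|s cs]; last first.
    by apply: (@labp_dvd _ j.*2); [rewrite dvdn2 odd_double | apply: cycp_labp cs; lia].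
  case: (eqVneq u v) => [->|uv] /=; first by rewrite eqxx.
  by have := c0 u v uv; have := clt u v uv; lia.
have G1 := unddec_bind (p := @fst _ 'I_p) (fun s => @cyclic_lift _ p s) G.
have G2 : unddec (labp k) (fun u v : 'I_j.*2 * 'I_p => (u.1./2 != v.1./2) : nat) (j.-1 * p).
  by apply: unddec_mono G1 => s; exact: labp_dvd.
have := unddec_bind (p := @fst _ bool) (fun s => haggkvist k1 (s := s)) G2.
pose f (u : 'I_j * (bool * 'I_p * bool)) : 'I_j.*2 * 'I_p * bool :=
  (join_ord (u.1, u.2.1.1), u.2.1.2, u.2.2).
pose g (u : 'I_j.*2 * 'I_p * bool) : 'I_j * (bool * 'I_p * bool) :=
  ((split_ord u.1.1).1, ((split_ord u.1.1).2, u.1.2, u.2)).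
have fK : cancel f g by move=> [i [[b x] a]]; rewrite /f /g join_ordK.
have gK : cancel g f.
  by move=> [[i x] a]; rewrite /f /g /= -[X in (X, _, _)]/(join_ord (split_ord i)) split_ordK.
move=> /(unddec_iso_cycp fK gK); apply: eq_unddec => u v /=.
by rewrite !half_bit_double.
Qed.

Lemma complete_HWP (T : finType) j p k r s c a b : 0 < j -> 0 < p -> 1 < k -> k %| p.*2 ->
  #|T| = 4 * p -> complete_sol T k.*2 r s c -> a + b = c + j.-1 * p * 2 ->
  HWP_has_solution (j * (4 * p)) 2 (r + a.*2) k.*2 (s + b.*2).
Proof.
move=> j0 p0 k1 kp cT S ab.
have cT' : #|T| = #|{: bool * 'I_p * bool}|.
  by rewrite !card_prod card_bool card_ord cT; lia.
have := sol_blocks (complete_sol_card cT' S) (cross_unddec j0 k1 kp).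
move=> /(@complete_sol_card _ 'I_(j * (4 * p))) H.
apply: sol_HWP (H _) ab; rewrite ?odd_double //; try lia.
  by rewrite !card_prod card_bool !card_ord; lia.
Qed.

(** * Explicit decompositions *)

Definition pts c ns : seq seg := [seq Pt (n, c) | n <- ns].

(* Found by computer search. In the [ham] and [half] lists the first five factors
   are directed and the last one is undirected; the three [und] factors are
   undirected. The first three factors of [k8_cycles] and the first seven of
   [k12_cycles] are directed, the last two undirected. *)
Definition ham_strip : seq (seq (seq seg)) := [::
  [:: pts 0 [:: 0; 3] ++ pts 4 [:: 10; 9] ++ [:: Dn (8, 0) 3 [::]] ++
      pts 0 [:: 7; 1; 4; 6; 5] ++ [:: Up (8, 0) 0 [:: 2; 1]] ++ pts 0 [:: 2]];
  [:: pts 0 [:: 0; 5; 6; 4] ++ [:: Up (8, 0) 0 [::]] ++ pts 4 [:: 11; 9] ++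
      pts 0 [:: 3; 1; 2] ++ [:: Dn (8, 0) 2 [:: 1; 3]] ++ pts 0 [:: 7]];
  [:: pts 0 [:: 0; 7] ++ [:: Up (8, 0) 3 [::]] ++ pts 0 [:: 2] ++ [:: Dn (8, 0) 0 [::]] ++
      pts 0 [:: 4; 5] ++ [:: Up (8, 0) 1 [::]] ++ [:: Dn (8, 0) 2 [::]] ++ pts 0 [:: 6; 1; 3]];
  [:: pts 0 [:: 0; 2; 1; 6; 7] ++ [:: Up (8, 0) 2 [:: 0; 3]] ++ pts 0 [:: 3] ++
      pts 4 [:: 11; 8] ++ [:: Dn (8, 0) 1 [::]] ++ pts 0 [:: 5; 4]];
  [:: pts 0 [:: 0; 4; 1; 7; 6] ++ [:: Up (8, 0) 2 [::]] ++ pts 0 [:: 2] ++ pts 4 [:: 11] ++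
      pts 0 [:: 3] ++ pts 4 [:: 9] ++ [:: Dn (8, 0) 0 [:: 3; 1]] ++ pts 0 [:: 5]];
  [:: pts 0 [:: 0; 6] ++ [:: Up (8, 0) 3 [:: 2]] ++ pts 4 [:: 10; 8] ++ pts 0 [:: 3; 2] ++
      [:: Dn (8, 0) 1 [:: 0]] ++ pts 0 [:: 4; 7; 5; 1]]].

Definition und_strip1 : seq (seq (seq seg)) := [::
  [:: pts 0 [:: 0; 2] ++ pts 16 [:: 18; 14] ++ [:: Dn (12, 0) 0 [:: 2; 1; 4; 8; 10; 9; 12]] ++
      pts 0 [:: 8; 10; 6; 5; 7];
      pts 0 [:: 1; 3] ++ pts 16 [:: 17; 19; 16; 13] ++
          [:: Dn (12, 0) 3 [:: 6; 5; 7; 11; 14; 13; 15]] ++ pts 0 [:: 11; 9; 4]];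
  [:: pts 0 [:: 0; 3] ++ pts 16 [:: 19] ++ [:: Dn (12, 0) 2 [:: 7; 4; 6; 10; 15; 12; 14]] ++
      pts 0 [:: 10; 7; 11; 8; 4; 6];
      pts 0 [:: 1; 2] ++ pts 16 [:: 16; 18; 15; 12; 17] ++
          [:: Dn (12, 0) 1 [:: 3; 0; 5; 9; 11; 8; 13]] ++ pts 0 [:: 9; 5]];
  [:: pts 0 [:: 0; 4; 7; 1; 6; 11] ++ [:: Up (12, 0) 2 [:: 6; 11; 15]] ++
      [:: Dn (12, 0) 1 [:: 5; 8; 12]] ++ pts 0 [:: 8; 5];
      pts 0 [:: 2] ++ pts 16 [:: 17; 18] ++ pts 0 [:: 3] ++ pts 16 [:: 16] ++
          [:: Dn (12, 0) 0 [:: 4; 9; 13]] ++ pts 0 [:: 9; 10] ++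
              [:: Up (12, 0) 3 [:: 7; 10; 14]] ++ pts 16 [:: 19]]].

Definition und_strip3 : seq (seq (seq seg)) := [::
  [:: pts 0 [:: 0; 3] ++ pts 16 [:: 27; 23; 18] ++
      [:: Dn (16, 0) 0 [:: 2; 1; 4; 8; 10; 9; 12]] ++ pts 0 [:: 12; 8; 4; 7; 10; 14; 11; 6];
      pts 0 [:: 1; 2] ++ pts 16 [:: 24; 26; 25; 20; 17; 21; 22] ++
          [:: Dn (16, 0) 3 [:: 6; 5; 7; 11; 14; 13; 15]] ++ pts 0 [:: 15; 13; 9; 5]];
  [:: pts 0 [:: 0; 2] ++ pts 16 [:: 26; 23; 20; 24; 21; 16; 19] ++
      [:: Dn (16, 0) 1 [:: 3; 0; 5; 9; 11; 8; 13]] ++ pts 0 [:: 13; 8; 5; 7];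
      pts 0 [:: 1; 3] ++ pts 16 [:: 25; 27; 22] ++
          [:: Dn (16, 0) 2 [:: 7; 4; 6; 10; 15; 12; 14]] ++
              pts 0 [:: 14; 12; 15; 11; 9; 10; 6; 4]];
  [:: pts 0 [:: 0; 4; 9; 12] ++ [:: Up (16, 0) 1 [:: 5; 8; 12]] ++
      [:: Dn (16, 0) 2 [:: 6; 11; 15]] ++ pts 0 [:: 15; 10; 8; 11; 7; 1; 6; 5];
      pts 0 [:: 2] ++ pts 16 [:: 25; 21; 23] ++ [:: Dn (16, 0) 3 [:: 7; 10; 14]] ++
          pts 0 [:: 14; 13] ++ [:: Up (16, 0) 0 [:: 4; 9; 13]] ++ pts 16 [:: 20; 22; 26] ++
              pts 0 [:: 3] ++ pts 16 [:: 24; 27]]].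

Definition half_strip : seq (seq (seq seg)) := [::
  [:: pts 0 [:: 0; 3] ++ pts 8 [:: 16; 19] ++ [:: Dn (16, 4) 1 [::]] ++ pts 4 [:: 13; 15] ++
      [:: Up (16, 4) 2 [:: 0; 3]] ++ pts 0 [:: 2; 1];
      pts 0 [:: 4] ++ [:: Up (8, 0) 0 [::]] ++ pts 4 [:: 12; 14] ++ [:: Dn (8, 0) 3 [::]] ++
          pts 0 [:: 7; 6] ++ [:: Up (8, 0) 2 [::]] ++ [:: Dn (8, 0) 1 [::]] ++ pts 0 [:: 5]];
  [:: pts 0 [:: 0; 2; 3; 1; 4; 6; 5] ++ [:: Up (8, 0) 1 [::]] ++ [:: Dn (8, 0) 2 [:: 0; 3]] ++
      pts 0 [:: 7];
      pts 4 [:: 8; 11; 14] ++ [:: Up (16, 4) 2 [::]] ++ [:: Dn (16, 4) 3 [::]] ++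
          pts 4 [:: 15; 13] ++ [:: Up (16, 4) 1 [::]] ++ [:: Dn (16, 4) 0 [::]] ++
              pts 4 [:: 12]];
  [:: pts 0 [:: 0; 7] ++ [:: Up (8, 0) 2 [:: 1; 3]] ++ pts 4 [:: 14; 13] ++
      [:: Dn (8, 0) 0 [::]] ++ pts 0 [:: 4; 1; 5; 6];
      pts 0 [:: 2] ++ [:: Dn (16, 4) 2 [:: 1; 3]] ++ pts 4 [:: 15; 11; 9; 12] ++
          [:: Up (16, 4) 0 [::]] ++ pts 0 [:: 3] ++ pts 8 [:: 17; 19]];
  [:: pts 0 [:: 0; 1; 2] ++ pts 8 [:: 19; 16] ++ [:: Dn (16, 4) 2 [::]] ++ pts 4 [:: 14; 12] ++
      [:: Up (16, 4) 1 [:: 3; 0]] ++ pts 0 [:: 3];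
      pts 0 [:: 4; 5] ++ [:: Up (8, 0) 0 [:: 3; 1]] ++ pts 4 [:: 13; 9; 11; 15] ++
          [:: Dn (8, 0) 2 [::]] ++ pts 0 [:: 6; 7]];
  [:: pts 0 [:: 0; 6; 4; 7] ++ [:: Up (8, 0) 3 [::]] ++ [:: Dn (8, 0) 0 [:: 2; 1]] ++
      pts 0 [:: 5; 1; 3; 2];
      pts 4 [:: 9; 13; 14; 10; 15] ++ [:: Up (16, 4) 3 [::]] ++ pts 8 [:: 18; 16] ++
          [:: Dn (16, 4) 1 [:: 2; 0]] ++ pts 4 [:: 12]];
  [:: pts 0 [:: 0; 5; 7; 1; 6] ++ [:: Up (8, 0) 3 [:: 2]] ++ pts 4 [:: 10; 8] ++
      [:: Dn (8, 0) 1 [:: 0]] ++ pts 0 [:: 4];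
      pts 0 [:: 2] ++ [:: Dn (16, 4) 0 [:: 1]] ++ pts 4 [:: 13; 12; 15; 14] ++
          [:: Up (16, 4) 3 [:: 2]] ++ pts 0 [:: 3] ++ pts 8 [:: 18; 17]]].

Definition ham_small : seq (seq (seq seg)) := [::
  [:: pts 0 [:: 0; 3; 1; 6; 2; 7; 5; 4]];
  [:: pts 0 [:: 0; 2; 6; 3; 4; 5; 7; 1]];
  [:: pts 0 [:: 0; 4; 3; 6; 1; 7; 2; 5]];
  [:: pts 0 [:: 0; 1; 5; 2; 4; 6; 7; 3]];
  [:: pts 0 [:: 0; 5; 1; 3; 7; 6; 4; 2]];
  [:: pts 0 [:: 0; 7; 4; 1; 2; 3; 5; 6]]].

Definition und_small : seq (seq (seq seg)) := [::
  [:: pts 0 [:: 0; 4; 7; 10; 9; 3]; pts 0 [:: 1; 2; 11; 8; 5; 6]];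
  [:: pts 0 [:: 0; 2; 8; 4; 9; 5]; pts 0 [:: 1; 7; 11; 6; 10; 3]];
  [:: pts 0 [:: 0; 6; 4; 1; 5; 7]; pts 0 [:: 2; 10; 8; 3; 11; 9]]].

Definition half_small : seq (seq (seq seg)) := [::
  [:: pts 0 [:: 0; 5; 9; 3; 1; 2]; pts 0 [:: 4; 8; 10; 11; 7; 6]];
  [:: pts 0 [:: 0; 7; 5; 1; 4; 6]; pts 0 [:: 2; 9; 11; 8; 3; 10]];
  [:: pts 0 [:: 0; 2; 10; 6; 1; 3]; pts 0 [:: 4; 5; 7; 11; 9; 8]];
  [:: pts 0 [:: 0; 3; 9; 5; 4; 7]; pts 0 [:: 1; 6; 10; 8; 11; 2]];
  [:: pts 0 [:: 0; 6; 7; 4; 1; 5]; pts 0 [:: 2; 11; 10; 3; 8; 9]];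
  [:: pts 0 [:: 0; 4; 9; 10; 7; 1]; pts 0 [:: 2; 8; 5; 6; 11; 3]]].

Definition k8_cycles : seq (seq (seq seg)) := [::
  [:: pts 0 [:: 0; 1; 3; 2]; pts 0 [:: 4; 6; 7; 5]];
  [:: pts 0 [:: 0; 4; 5; 1]; pts 0 [:: 2; 3; 7; 6]];
  [:: pts 0 [:: 0; 2; 6; 4]; pts 0 [:: 1; 5; 7; 3]];
  [:: pts 0 [:: 0; 3; 4; 7]; pts 0 [:: 1; 2; 5; 6]];
  [:: pts 0 [:: 0; 5; 3; 6]; pts 0 [:: 1; 4; 2; 7]]].

Definition k12_cycles : seq (seq (seq seg)) := [::
  [:: pts 0 [:: 0; 6; 4; 1]; pts 0 [:: 2; 9; 3; 8]; pts 0 [:: 5; 10; 7; 11]];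
  [:: pts 0 [:: 0; 1; 3; 11]; pts 0 [:: 2; 5; 4; 6]; pts 0 [:: 7; 10; 9; 8]];
  [:: pts 0 [:: 0; 9; 2; 6]; pts 0 [:: 1; 8; 5; 11]; pts 0 [:: 3; 10; 4; 7]];
  [:: pts 0 [:: 0; 7; 4; 10]; pts 0 [:: 1; 2; 11; 3]; pts 0 [:: 5; 8; 9; 6]];
  [:: pts 0 [:: 0; 10; 2; 8]; pts 0 [:: 1; 11; 7; 6]; pts 0 [:: 3; 9; 4; 5]];
  [:: pts 0 [:: 0; 11; 4; 9]; pts 0 [:: 1; 6; 7; 8]; pts 0 [:: 2; 10; 3; 5]];
  [:: pts 0 [:: 0; 8; 3; 7]; pts 0 [:: 1; 4; 11; 2]; pts 0 [:: 5; 6; 9; 10]];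
  [:: pts 0 [:: 0; 2; 7; 5]; pts 0 [:: 1; 9; 11; 10]; pts 0 [:: 3; 4; 8; 6]];
  [:: pts 0 [:: 0; 3; 2; 4]; pts 0 [:: 1; 5; 9; 7]; pts 0 [:: 6; 10; 8; 11]]].

(** * Decompositions of single blocks *)

Lemma strip_complete q wc l0 parts l1 (b : bool) ms D U k t :
  strip_check (2 * (2 * wc)) ms (ladder_vertsS wc l0 parts l1) D U
    (ladder_graphS wc l0 parts l1 b) ->
  t = aval q (ladder_t wc l0 parts l1) -> aval q ms = k.*2 -> 1 < k -> k %| t.*2 ->
  complete_sol 'I_t.*2.*2 k.*2 (~~ b) (size D) (size U + (t - 2) * 2).
Proof.
move=> chk tE mE k1 kt.
have t1 : 1 < t by rewrite tE /aval; have := ladder_t_ge2 wc l0 parts l1; lia.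
apply: complete_ladder => //.
have := strip_dec chk mE (ladder_vertsSE tE); apply: eq_sol => x y.
exact: ladder_graphSE.
Qed.

(** For blocks of [m = 4 * t] vertices and even [r]. The doubled ladder with I has degree 7, that is
    5 directed factors and one undirected; 5 is the least odd [s] other than 1 and 3. *)
Lemma ham_complete t : 1 < t ->
  complete_sol 'I_t.*2.*2 t.*2.*2 0 5 (1 + (t - 2) * 2).
Proof.
move=> t1; have [->|t2] : t = 2 \/ 2 < t by lia.
  by apply: (@strip_complete 0 1 0 [::] 0 true (8, 0) (take 5 ham_small) (drop 5 ham_small)).
(* Two columns precede the repeated one and one follows it. *)
apply: (@strip_complete (t - 3) 1 1 [:: None] 0 true (12, 4) (take 5 ham_strip) (drop 5 ham_strip)).
- by vm_compute.
- by rewrite /aval /=; lia.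
- by rewrite /aval /=; lia.
- by lia.
- exact: dvdnn.
Qed.

(** For blocks of [2 * m] vertices, [m = 2 * t], and odd [r]. I is a K_2^*-factor, and the doubled
    ladder, of degree 6, splits into three undirected factors. *)
Lemma und_complete t : odd t -> 1 < t ->
  complete_sol 'I_t.*2.*2 t.*2 1 0 (3 + (t - 2) * 2).
Proof.
move=> ot t1; have dt : t %| t.*2 by rewrite -muln2 dvdn_mulr.
have := odd_double_half t; have := odd_double_half t./2; rewrite ot.
(* The window has four columns, so the residues 3 and 1 of [t] modulo 4 need separate strips, with 7
   and 5 columns outside the window. *)
case: (odd t./2) => t4 t2.
  have [t3|t3] : t = 3 \/ 6 < t by lia.
    by apply: (@strip_complete 0 1 0 [::] 1 false (6, 0) [::] und_small);
      rewrite ?t3.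
  apply: (@strip_complete ((t - 7) %/ 4) 4 3 [:: None] 2 false (14, 8) [::] und_strip3).
  - by vm_compute.
  - by rewrite /aval /=; lia.
  - by rewrite /aval /=; lia.
  - by lia.
  - exact: dt.
apply: (@strip_complete ((t - 5) %/ 4) 4 2 [:: None] 1 false (10, 8) [::] und_strip1).
- by vm_compute.
- by rewrite /aval /=; lia.
- by rewrite /aval /=; lia.
- by lia.
- exact: dt.
Qed.

Lemma half_complete t : odd t -> 1 < t ->
  complete_sol 'I_t.*2.*2 t.*2 0 5 (1 + (t - 2) * 2).
Proof.
move=> ot t1; have dt : t %| t.*2 by rewrite -muln2 dvdn_mulr.
have := odd_double_half t; rewrite ot => t2.
have [t3|t3] : t = 3 \/ 3 < t by lia.
  by apply: (@strip_complete 0 1 0 [::] 1 true (6, 0) (take 5 half_small) (drop 5 half_small));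
    rewrite ?t3.
(* Each factor has two cycles; one absorbs the first window and the other the second, so both grow
   by four vertices per repetition. *)
apply: (@strip_complete ((t - 5)./2) 1 1 [:: None; Some 2; None] 0 true (10, 4)
  (take 5 half_strip) (drop 5 half_strip)).
- by vm_compute.
- by rewrite /aval /=; lia.
- by rewrite /aval /=; lia.
- by lia.
- exact: dt.
Qed.

Definition completeS n : seq (affine * affine) * seq (affine * affine) :=
  ([seq ((p.1, 0), (p.2, 0)) | p <- [seq p <- [seq (i, j) | i <- iota 0 n, j <- iota 0 n] | p.1 != p.2]],
   [::]).

Lemma completeSE w n (x y : 'I_n) : arcmul w 0 (completeS n) x y = (x != y).
Proof.
rewrite /arcmul count_conc big_geq // addn0 /= count_map.
rewrite (@eq_count _ _ (pred1 (x : nat, y : nat))); last first.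
  by move=> [i j]; rewrite /= /ev2 /ev1 /aval /= !mul0n !muln0 !addn0.
rewrite count_uniq_mem; last by rewrite filter_uniq // allpairs_uniq ?iota_uniq // => -[? ?] [].
rewrite mem_filter /= allpairs_f ?mem_iota ?ltn_ord //.
by rewrite andbT.
Qed.

(** With [q = 0] the symbolic check is an ordinary check of explicit lists. *)
Lemma small_complete n m D U : 0 < m ->
  strip_check 0 (m, 0) ([seq (i, 0) | i <- iota 0 n], [::]) D U (completeS n) ->
  complete_sol 'I_n m 0 (size D) (size U).
Proof.
move=> m0 chk; have := @strip_dec 0 0 n _ _ _ _ _ m chk.
move=> H; apply: eq_sol (H _ _) => [x y|//|]; first exact: completeSE.
  by rewrite /aval /= muln0 addn0.
rewrite /conc /= cats0 -map_comp (@eq_map _ _ _ id) ?map_id // => i.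
by rewrite /= /ev1 /aval /= !muln0 !addn0.
Qed.

(** * Assembling the solution from blocks *)

Lemma block_HWP (T : finType) j p k r0 s0 c r s m v :
  complete_sol T k.*2 r0 s0 c -> #|T| = 4 * p -> (r0 + s0 + c.*2).+1 = 4 * p ->
  0 < v -> v = j * (4 * p) -> m = k.*2 -> 1 < k -> k %| p.*2 ->
  r0 <= r -> s0 <= s -> odd r = odd r0 -> r + s = v - 1 ->
  HWP_has_solution v 2 r m s.
Proof.
move=> S cT cE v0 vE mE k1 kp r0r s0s odr rs.
have j0 : 0 < j by move: v0; rewrite vE; case: (j).
have p0 : 0 < p by lia.
have vE4 : v = 4 * (j * p) by rewrite vE; lia.
have rE : r = r0 + (r - r0)./2.*2.
  by have := odd_double_half (r - r0); rewrite oddB // odr addbb; lia.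
(* Both [r + s] and [r0 + s0] are odd, so equal parities of [r] and [r0] give the same for [s] and
   [s0]. *)
have ods : odd s = odd s0.
  have : odd (r + s) = odd (r0 + s0).
    have -> : odd (r + s) = true by rewrite rs vE4 oddB ?oddM //; lia.
    by have := congr1 odd cE; rewrite oddM /= !oddD odd_double addbF; case: (_ (+) _).
  by rewrite !oddD odr; case: (odd r0); case: (odd s); case: (odd s0).
have sE : s = s0 + (s - s0)./2.*2.
  by have := odd_double_half (s - s0); rewrite oddB // ods addbb; lia.
have := complete_HWP (a := (r - r0)./2) (b := (s - s0)./2) j0 p0 k1 kp cT S.
rewrite -vE -rE -sE -mE; apply.
have jp : j.-1 * p + p = j * p by rewrite -mulSnr prednK.
have jp2 : j.-1 * p * 2 = (j.-1 * p).*2 by rewrite muln2.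
move: (j.-1 * p) (j * p) jp jp2 vE4 => u w jp jp2 vE4.
by clear -jp jp2 vE4 rE sE rs cE; lia.
Qed.

Theorem theorem3 (r s v m : nat) (hv : 0 < v) (hm : 4 <= m)
  (hm_even : ~~ odd m) (hmv : m %| v) (hrs : r + s = v - 1) (hs1 : s <> 1)
  (hrv : (r, v) <> (0, 6)) (hmrv : (m, r, v) <> (4, 0, 4))
  (hcond :
     (4 < m /\ s <> 3 /\ m = 0 %[mod 4]) \/
     (4 < m /\ ~~ odd (v %/ m) /\ s <> 3 /\ m = 2 %[mod 4]) \/
     (m = 4 /\ (v = 0 %[mod 24] \/ v = 8 %[mod 24] \/ v = 16 %[mod 24])) \/
     (m = 4 /\ v = 12 %[mod 24] /\ s <> 3 /\ s <> 5) \/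
     (m = 4 /\ (v = 4 %[mod 24] \/ v = 20 %[mod 24]) /\ odd r)) :
  HWP_has_solution v 2 r m s.
Proof.
have vE := divnK hmv; set j := v %/ m in vE hcond.
have ev : ~~ odd v by rewrite -vE oddM negb_and hm_even orbT.
have orE : odd r = ~~ odd s.
  have : odd (r + s) by rewrite hrs oddB // (negbTE ev).
  by rewrite oddD; case: odd; case: odd.
have modE : 4 %| m \/ m = 2 %[mod 4] /\ ~~ odd j /\ s <> 3.
  by case: hcond => [|[|[|[|]]]]; clear; lia.
(* For odd [s] the number [r] is even, which excludes the last condition; the remaining ones with
   [m = 4] allow blocks of 8 or 12 vertices. *)
have mod4 : m = 4 -> odd s -> 8 %| v \/ 12 %| v /\ s <> 3 /\ s <> 5.
  by move=> m4 os; move: orE; rewrite os; case: (odd r) hcond m4 => // hcond m4 _;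
    case: hcond => [|[|[|[|]]]]; clear -m4; lia.
have s3 : 4 < m -> s <> 3 by case: hcond => [|[|[|[|]]]]; clear; lia.
clear hcond hrv hmrv; case: modE => [/dvdnP[p mE]|[m2 [ej _]]].
  have m_p : m = p.*2.*2 by rewrite mE; clear; lia.
  have p0 : 0 < p by move: hm; rewrite m_p; clear; lia.
  have vEp : v = j * (4 * p) by rewrite -vE mE (mulnC p).
  case: (boolP (odd r)) => odr.
    (* For odd [r] the blocks are copies of K_m, each split into a matching and Hamiltonian
       cycles. *)
    have p2 : 1 < p.*2 by clear -p0; lia.
    apply: (block_HWP (complete_even_cycles p2) _ _ hv vEp m_p) => //.
    - by rewrite card_ord; clear; lia.
    - by clear -p0; lia.
    - by case: (r) odr.
  have ods : odd s by move: orE; rewrite (negbTE odr) => /esym/negbFE.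
  have s2 : 2 < s by case: (s) ods hs1 => [|[|[|]]].
  have [p1|p1] : p = 1 \/ 1 < p by clear -p0; lia.
    have m4 : m = 4 by rewrite mE p1.
    (* The blocks of 8 and 12 vertices begin with 3 and 7 directed factors, the least odd values of
       [s] that are left. *)
    case: (mod4 m4 ods) => [/dvdnP[i vi]|[/dvdnP[i vi] [s3' s5]]].
      have S := @small_complete 8 4 (take 3 k8_cycles) (drop 3 k8_cycles) isT ltac:(by vm_compute).
      by apply: (block_HWP S (j := i) (p := 2) (k := 2)); rewrite ?card_ord // (negbTE odr).
    have s6 : 6 < s by case: (s) ods hs1 s3' s5 => [|[|[|[|[|[|[|]]]]]]].
    have S := @small_complete 12 4 (take 7 k12_cycles) (drop 7 k12_cycles) isT ltac:(by vm_compute).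
    by apply: (block_HWP S (j := i) (p := 3) (k := 2)); rewrite ?card_ord // (negbTE odr).
  have s4 : 4 < s.
    have m4 : 4 < m by rewrite m_p; clear -p1; lia.
    by case: (s) ods s2 (s3 m4) => [|[|[|[|[|]]]]].
  apply: (block_HWP (ham_complete p1) _ _ hv vEp m_p) => //.
  - by rewrite card_ord; clear; lia.
  - by clear -p1; lia.
  - by clear -p0; lia.
  - by rewrite (negbTE odr).
(* Now [m] is 2 modulo 4 and a block has [2 * m = 4 * k] vertices, which is possible because [j] is
   even. *)
have mE : m = m./2.*2 by rewrite -[LHS]odd_double_half (negbTE hm_even).
move: mE; set k := m./2 => mE.
have ok : odd k by clear -m2 mE; lia.
have k2 : 1 < k by clear -hm mE; lia.
have m4 : 4 < m by move: ok hm; rewrite mE; case: (k) => [|[|[|]]].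
have jE : j = j./2.*2 by rewrite -[LHS]odd_double_half (negbTE ej).
have vE4 : v = j./2 * (4 * k) by rewrite -vE mE [in LHS]jE; clear; lia.
have kk : k %| k.*2 by rewrite -muln2 dvdn_mulr.
case: (boolP (odd r)) => odr.
  apply: (block_HWP (und_complete ok k2) _ _ hv vE4 mE) => //.
  - by rewrite card_ord; clear; lia.
  - by clear -k2; lia.
  - by case: (r) odr.
have ods : odd s by move: orE; rewrite (negbTE odr) => /esym/negbFE.
have s4 : 4 < s by case: (s) ods hs1 (s3 m4) => [|[|[|[|[|]]]]].
apply: (block_HWP (half_complete ok k2) _ _ hv vE4 mE) => //.
- by rewrite card_ord; clear; lia.
- by clear -k2; lia.
- by rewrite (negbTE odr).
Qed.
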